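(* Let $p$ be a locally Lipschitz probability density on $G$ and let $q$ be a probability density on $G$. Suppose $k\in C^2(G\times G)$ and the function $x\mapsto\sqrt{k_p(x,x)}$ is both $p$-integrable and $q$-integrable. Then the map $x\mapsto \mathcal{A}^l_p k_x$ from $G$ to $\mathcal{H}_k$ is Bochner $q$-integrable (for each $l=1,\dots,d$), and $$\mathrm{KSD}^2(p,q)=\int_G\int_G k_p(x,y)\,q(x)\,q(y)\,\mu(dx)\,\mu(dy).$$
   Context: $G$ is a connected Lie group of dimension $d$ with left-invariant Haar measure $\mu$; all densities are with respect to $\mu$. The modular function $\Delta:G\to(0,\infty)$ is defined by $\mu(Sg)=\Delta(g)\mu(S)$ for Borel sets $S$. $D^1,\dots,D^d$ is a left-invariant basis, i.e. left-invariant vector fields forming a basis of the tangent space at every point. $k:G\times G\to\mathbb{R}$ is a kernel function with reproducing kernel Hilbert space $\mathcal{H}_k$, and $\mathcal{H}_k^d$ is its $d$-fold product with $\langle f,g\rangle_{\mathcal{H}_k^d}=\sum_{l=1}^d\langle f_l,g_l\rangle_{\mathcal{H}_k}$. When $k\in C^2(G\times G)$ (twice continuously differentiable), all elements of $\mathcal{H}_k$ are $C^1$. For the locally Lipschitz probability density $p$ (which may be known only up to a constant) and $h\in\mathcal{H}_k$ put $\mathcal{A}^l_p h:=D^l h+h\,D^l\log p+h\,D^l\Delta$, where $D^l\log p$ is set to $0$ wherever $p=0$. For $f=(f_1,\dots,f_d)\in\mathcal{H}_k^d$ put $\mathcal{A}_pf:=\sum_{l=1}^d\mathcal{A}^l_pf_l=\sum_{l=1}^d[D^lf_l+f_l\,D^l\log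 p+f_l\,D^l\Delta]$ (the Stein operator). The kernel Stein discrepancy is $$\mathrm{KSD}(p,q):=\sup\{\mathbb{E}_q[\mathcal{A}_pf]: f\in\mathcal{H}_k^d,\ \|f\|_{\mathcal{H}_k^d}\le 1\}.$$ $\mathcal{A}^l_pk_x\in\mathcal{H}_k$ denotes the function obtained by letting $\mathcal{A}^l_p$ act on the first argument of $k$ and then fixing that argument at $x$. Finally $$k_p(x,y):=\sum_{l=1}^d\tilde{\mathcal{A}}^l_p\mathcal{A}^l_pk(x,y)=\sum_{l=1}^d\langle\mathcal{A}^l_pk_x,\mathcal{A}^l_pk_y\rangle_{\mathcal{H}_k},$$ where the tilde means the operator acts on the second argument. *)

(* Defs.v *)
From HB Require Import structures.
From mathcomp Require Import all_boot all_order all_algebra.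
From mathcomp Require Import all_classical all_reals all_analysis.

Set Implicit Arguments.
Unset Strict Implicit.
Unset Printing Implicit Defensive.

Import Order.TTheory GRing.Theory Num.Theory.
Import numFieldNormedType.Exports.

Local Open Scope classical_set_scope.
Local Open Scope ring_scope.

Section Differentiability.
Variable R : realType.

Fixpoint Cn_on (m n : nat) (U : set 'rV[R]_m) (f : 'rV[R]_m -> R) : Prop :=
  (forall x, U x -> {for x, continuous f}) /\
  match n with
  | 0%N => True
  | n'.+1 => forall i : 'I_m,
      (forall x, U x -> derivable f x (delta_mx 0 i)) /\
      Cn_on n' U (fun x => 'D_(delta_mx 0 i) f x)
  end.

Definition smooth_on (m p : nat) (U : set 'rV[R]_m)
    (f : 'rV[R]_m -> 'rV[R]_p) : Prop :=
  forall (n : nat) (j : 'I_p), Cn_on n U (fun x => f x 0 j).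

(* [chart_inv c] is only meaningful on [chart_cod c]. *)
Record chart (d : nat) (T : topologicalType) := Chart {
  chart_dom : set T;
  chart_fun :> T -> 'rV[R]_d;
  chart_inv : 'rV[R]_d -> T;
  chart_dom_open : open chart_dom;
  chart_cod_open : open (chart_fun @` chart_dom);
  chart_funK : {in chart_dom, cancel chart_fun chart_inv};
  chart_fun_continuous :
    forall x, chart_dom x -> {for x, continuous chart_fun};
  chart_inv_continuous :
    forall y, (chart_fun @` chart_dom) y -> {for y, continuous chart_inv} }.

Definition chart_cod (d : nat) (T : topologicalType) (c : chart d T) :
  set 'rV[R]_d := c @` chart_dom c.

End Differentiability.

HB.mixin Record isTopologicalGroup G & Group G & PointedTopological G := {
  mulg_continuous : continuous (fun z : G * G => (z.1 * z.2)%g);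
  invg_continuous : continuous (fun x : G => (x^-1)%g) }.

#[short(type="topologicalGroupType")]
HB.structure Definition TopologicalGroup :=
  {G of Group G & PointedTopological G & isTopologicalGroup G}.

(* Besides the atlas, the structure singles out a preferred chart [chart_at x]
   around each point x; it is used only to represent tangent vectors at x by
   coordinate vectors. *)
HB.mixin Record isLieGroup (R : realType) (d : nat) G & TopologicalGroup G := {
  lie_hausdorff : hausdorff_space G;
  lie_second_countable : @second_countable G;
  atlas : set (chart R d G);
  chart_at : G -> chart R d G;
  chart_at_atlas : forall x, atlas (chart_at x);
  chart_at_dom : forall x, chart_dom (chart_at x) x;
  atlas_compatible : forall c c' : chart R d G, atlas c -> atlas c' ->
    smooth_on (c @` (chart_dom c `&` chart_dom c')) (c' \o chart_inv c);
  mulg_smooth : forall c1 c2 c3 : chart R d G,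
    atlas c1 -> atlas c2 -> atlas c3 ->
    smooth_on
      [set z : 'rV[R]_(d + d) | [/\ chart_cod c1 (lsubmx z),
         chart_cod c2 (rsubmx z) &
         chart_dom c3 (chart_inv c1 (lsubmx z) * chart_inv c2 (rsubmx z))%g]]
      (fun z => c3 (chart_inv c1 (lsubmx z) * chart_inv c2 (rsubmx z))%g);
  invg_smooth : forall c1 c2 : chart R d G, atlas c1 -> atlas c2 ->
    smooth_on [set y | chart_cod c1 y /\ chart_dom c2 (chart_inv c1 y)^-1%g]
      (fun y => c2 (chart_inv c1 y)^-1%g) }.

#[short(type="lieGroupType")]
HB.structure Definition LieGroup (R : realType) (d : nat) :=
  {G of TopologicalGroup G & isLieGroup R d G}.

Section LieGroupNotions.
Variables (R : realType) (d : nat) (G : lieGroupType R d).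

Definition Cn_prod (n : nat) (k : G -> G -> R) : Prop :=
  forall c1 c2 : chart R d G, atlas c1 -> atlas c2 ->
  Cn_on n
    [set z : 'rV[R]_(d + d) | chart_cod c1 (lsubmx z) /\
                              chart_cod c2 (rsubmx z)]
    (fun z => k (chart_inv c1 (lsubmx z)) (chart_inv c2 (rsubmx z))).

Definition locally_lipschitz (f : G -> R) : Prop :=
  forall c : chart R d G, atlas c ->
  [locally [lipschitz (f (chart_inv c y)) | y in chart_cod c]].

(* A tangent vector at x is given by its coordinates v in [chart_at x].
   [tangent_map g x v] is the derivative at x, in the direction v, of a map g
   defined near x. When the directional derivative does not exist (possible
   for merely locally Lipschitz g), the library's value is 0 for real-valued
   g. *)
Definition tangent_map (W : normedModType R) (g : G -> W) (x : G)
    (v : 'rV[R]_d) : W :=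
  'D_v (g \o chart_inv (chart_at x)) (chart_at x x).

Definition smooth_vector_field (X : G -> 'rV[R]_d) : Prop :=
  forall c : chart R d G, atlas c ->
  smooth_on (chart_cod c)
    (fun y => tangent_map c (chart_inv c y) (X (chart_inv c y))).

(* X (g x) is the image of X x under the differential of y |-> g y at x. *)
Definition left_invariant (X : G -> 'rV[R]_d) : Prop :=
  forall g x : G,
  X (g * x)%g = tangent_map (fun y => chart_at (g * x)%g (g * y)%g) x (X x).

Definition left_invariant_basis (D : 'I_d -> G -> 'rV[R]_d) : Prop :=
  (forall l, smooth_vector_field (D l) /\ left_invariant (D l)) /\
  (forall x, row_free (\matrix_(l < d) D l x)).

Definition vf_apply (X : G -> 'rV[R]_d) (f : G -> R) (x : G) : R :=
  tangent_map f x (X x).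

End LieGroupNotions.

Notation borel G := (g_sigma_algebraType (@open G)).

Section Measures.
Variables (R : realType) (d : nat) (G : lieGroupType R d).
Implicit Types mu : {measure set (borel G) -> \bar R}.

(* Inner and outer regularity are automatic, G being second countable. *)
Definition left_haar mu : Prop :=
  [/\ forall (g : G) (S : set (borel G)), measurable S ->
        mu ((fun x : G => (g * x)%g) @` S) = mu S,
      forall K : set G, compact K -> (mu K < +oo)%E &
      mu [set: borel G] != 0%E ].

Definition modular_function mu (Delta : G -> R) : Prop :=
  (forall g, 0 < Delta g) /\
  (forall (g : G) (S : set (borel G)), measurable S ->
    mu ((fun x : G => (x * g)%g) @` S) = ((Delta g)%:E * mu S)%E).

Definition probability_density mu (q : G -> R) : Prop :=
  [/\ measurable_fun [set: borel G] (q : borel G -> R),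
      forall x, 0 <= q x &
      (\int[mu]_x (q x)%:E = 1)%E ].

Definition density_measure mu (q : G -> R) (A : set (borel G)) : \bar R :=
  (\int[mu]_(x in A) (q x)%:E)%E.

End Measures.

Section Bochner.
Context {disp : measure_display} {T : measurableType disp} {R : realType}
  {H : normedModType R}.
Implicit Types (m : set T -> \bar R) (s F : T -> H).

Definition simple_function m s : Prop :=
  finite_set (range s) /\
  forall h : H, measurable (s @^-1` [set h]) /\
    (h != 0 -> (m (s @^-1` [set h]) < +oo)%E).

Definition strongly_measurable m F : Prop :=
  exists s : nat -> T -> H, (forall n, simple_function m (s n)) /\
    {ae m, forall x, s^~ x @ \oo --> F x}.

Definition bochner_integrable m F : Prop :=
  strongly_measurable m F /\
  exists s : nat -> T -> H, (forall n, simple_function m (s n)) /\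
    (\int[m]_x `|F x - s n x|%:E)%E @[n --> \oo] --> 0%E.

End Bochner.

Definition kernel_function (R : realType) (X : Type) (k : X -> X -> R) : Prop :=
  (forall x y, k x y = k y x) /\
  forall (n : nat) (x : 'I_n -> X) (a : 'I_n -> R),
    0 <= \sum_(i < n) \sum_(j < n) a i * a j * k (x i) (x j).

(* H is the reproducing kernel Hilbert space of k: a Hilbert space whose
   elements are identified with functions on X through the injection
   [rkhs_fun]. *)
Record rkhs (R : realType) (X : Type) (k : X -> X -> R)
    (H : completeNormedModType R) := RKHS {
  rkhs_dot : H -> H -> R;
  rkhs_dotC : forall f g, rkhs_dot f g = rkhs_dot g f;
  rkhs_dotDl : forall a f g h,
    rkhs_dot (a *: f + g) h = a * rkhs_dot f h + rkhs_dot g h;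
  rkhs_dot_norm : forall f, rkhs_dot f f = `|f| ^+ 2;
  rkhs_fun : H -> X -> R;
  rkhs_funD : forall a f g x,
    rkhs_fun (a *: f + g) x = a * rkhs_fun f x + rkhs_fun g x;
  rkhs_fun_inj : injective rkhs_fun;
  rkhs_section : X -> H;
  rkhs_sectionE : forall x y, rkhs_fun (rkhs_section x) y = k x y;
  rkhs_reproducing : forall f x, rkhs_dot f (rkhs_section x) = rkhs_fun f x }.

Section Stein.
Variables (R : realType) (d : nat) (G : lieGroupType R d).
Variables (D : 'I_d -> G -> 'rV[R]_d) (Delta : G -> R) (p : G -> R).

(* Since p is locally Lipschitz, D^l log p exists almost everywhere on
   {p > 0}; at the exceptional points its value is 0. *)
Definition Dlog (l : 'I_d) (x : G) : R :=
  if p x == 0 then 0 else vf_apply (D l) (fun y => ln (p y)) x.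

Definition stein_comp (l : 'I_d) (h : G -> R) (x : G) : R :=
  vf_apply (D l) h x + h x * Dlog l x + h x * vf_apply (D l) Delta x.

Definition stein_kernel (k : G -> G -> R) (x y : G) : R :=
  \sum_(l < d)
    stein_comp l (fun y' => stein_comp l (fun x' => k x' y') x) y.

Variables (k : G -> G -> R) (H : completeNormedModType R) (HK : rkhs k H).

Definition dot_prod (f g : 'I_d -> H) : R :=
  \sum_(l < d) rkhs_dot HK (f l) (g l).

Definition norm_prod (f : 'I_d -> H) : R := Num.sqrt (dot_prod f f).

Definition stein_op (f : 'I_d -> H) (x : G) : R :=
  \sum_(l < d) stein_comp l (rkhs_fun HK (f l)) x.

Definition KSD (mu : {measure set (borel G) -> \bar R}) (q : G -> R) : \bar R :=
  ereal_sup [set (\int[mu]_x (stein_op f x * q x)%:E)%E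
            | f in [set f : 'I_d -> H | norm_prod f <= 1]].

End Stein.

(* Main.v *)
From HB Require Import structures.
Require Import Defs.
From mathcomp Require Import all_boot all_order all_algebra.
From mathcomp Require Import all_classical all_reals all_analysis.
From mathcomp Require Import measurable_realfun.
From mathcomp Require Import ring lra.

Import Order.TTheory GRing.Theory Num.Theory.
Import numFieldNormedType.Exports.

Set Implicit Arguments.
Unset Strict Implicit.
Unset Printing Implicit Defensive.

Local Open Scope classical_set_scope.
Local Open Scope ring_scope.

(** Write [K x] for the section of the kernel at [x]. Since [k] is of class C^2,
    [K] is differentiable along smooth curves as a map into [H], and
    differentiating the reproducing property shows that the Stein operator is a
    bounded linear form at every point: with
    [Ak l x = D^l K x + (D^l log p x + D^l Delta x) K x] one has
    [stein_comp l f x = <f, Ak l x>] ([stein_representer]). Hence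
    [stein_kernel x y = sum_l <Ak l x, Ak l y>], so that [|Ak l x|] is at most
    the square root of [stein_kernel x x] and [Ak l] has [q]-integrable norm.

    Let [m l] be the mean of [Ak l] under the probability with density [q]
    ([weak_mean]). The expectation of [stein_op f] is then [sum_l <f l, m l>].
    Its supremum over the unit ball, the discrepancy, is the norm of [m]
    ([ereal_sup_dot_prod]), and integrating [<Ak l x, Ak l y>] in each variable
    in turn gives the square of that norm.

    The remaining issue is measurability: the preferred charts, through which
    derivatives are defined, vary arbitrarily with the point. Left invariance
    removes them. The field [D^l] is at every [x] the velocity of the left
    translate by [x] of one fixed curve through the identity
    ([left_invariant_velocity]), and for a function that is Lipschitz in charts
    the derivative depends on the curve only through its velocity
    ([lipschitz_curve_derive]). So [D^l f x] is a limit of difference quotients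
    that are measurable in [x], and so is the set where the limit exists
    ([measurable_lim_dnbhs0]). This applies to [log p] where [p] is positive, to
    [K], and to the modular function once the latter is known to be Lipschitz:
    its inverse is a constant multiple of the integral of a right translate of a
    fixed tent function, which depends on the translation in a Lipschitz way
    ([modular_lipschitz]). Finally, [Ak l] is a pointwise limit of combinations
    of continuous maps on a second countable space, so its values are
    approximated by a countable family, and it is a limit of simple functions
    with errors dominated by its own norm ([bochner_integrable_dense]). *)

(** * Functions with continuous partial derivatives *)

Section Calculus.
Context {R : realType}.

Lemma cvg_dnbhs0P (W : normedModType R) (g : R -> W) (l : W) :
  g h @[h --> (0 : R)^'] --> l <->
  forall e : R, 0 < e -> exists2 r : R, 0 < r &
    forall h, h != 0 -> `|h| < r -> `|g h - l| < e.
Proof.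
split=> [/cvgrPdist_lt gl e e0|gl].
  have /nbhs_ballP[r /= r0 H] := gl _ e0.
  exists r => // h h0 hr; rewrite distrC; apply: H => //.
  by rewrite -ball_normE /= sub0r normrN.
apply/cvgrPdist_lt => e e0; have [r r0 H] := gl _ e0.
apply/nbhs_ballP; exists r => //= h.
rewrite -ball_normE /= sub0r normrN => hr h0.
by rewrite distrC; apply: H.
Qed.

Lemma cvg_nbhsP (V W : normedModType R) (f : V -> W) (x : V) (l : W) :
  f y @[y --> x] --> l <->
  forall e : R, 0 < e -> exists2 r : R, 0 < r &
    forall y, ball x r y -> `|f y - l| < e.
Proof.
split=> [/cvgrPdist_lt fl e e0|fl].
  have /nbhs_ballP[r /= r0 H] := fl _ e0.
  by exists r => // y /H; rewrite distrC.
apply/cvgrPdist_lt => e e0; have [r r0 H] := fl _ e0.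
by apply/nbhs_ballP; exists r => //= y /H; rewrite distrC.
Qed.

Lemma is_deriveP (V W : normedModType R) (f : V -> W) (x v : V) (l : W) :
  is_derive x v f l <->
  h^-1 *: (f (h *: v + x) - f x) @[h --> (0 : R)^'] --> l.
Proof.
split=> [[+ <-]|fl]; first by [].
split; first by apply/cvg_ex; exists l.
exact: cvg_lim fl.
Qed.

Lemma ball_line (V : normedModType R) (x v : V) (r t : R) :
  `|t| < r / (`|v| + 1) -> ball x r (t *: v + x).
Proof.
rewrite ltr_pdivlMr ?ltr_wpDl// => tr.
rewrite -ball_normE /= opprD addrCA subrr addr0 normrN normrZ.
by apply: le_lt_trans tr; rewrite ler_wpM2l// lerDl.
Qed.

Lemma is_derive_scale (V W : normedModType R) (f : V -> W) (x v : V) (l : W)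
    (s : R) :
  is_derive x v f l -> is_derive x (s *: v) f (s *: l).
Proof.
have [->|s0] := eqVneq s 0; first by rewrite !scale0r => _; exact: is_derive0.
move=> /is_deriveP /cvg_dnbhs0P fl; apply/is_deriveP/cvg_dnbhs0P => e e0.
have sn0 : 0 < `|s| by rewrite normr_gt0.
have [r r0 H] := fl (e / `|s|) (divr_gt0 e0 sn0).
exists (r / `|s|) => [|h h0 hr]; first exact: divr_gt0.
have := H (h * s); rewrite mulf_neq0// normrM -ltr_pdivlMr// => /(_ isT hr).
rewrite ltr_pdivlMr// mulrC -normrZ scalerBr !scalerA.
by rewrite invfM mulrCA divff// mulr1.
Qed.

(** Parametrising the segment by the unit interval makes the sign of [s]
    immaterial. *)
Lemma mvt_line (V : normedModType R) (f df : V -> R) (z e : V) (s : R) :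
  (forall t : R, 0 <= t <= 1 ->
    is_derive ((t * s) *: e + z) e f (df ((t * s) *: e + z))) ->
  exists2 t : R, 0 <= t <= 1 &
    f (s *: e + z) - f z = s * df ((t * s) *: e + z).
Proof.
move=> fdf; pose g (t : R) := f ((t * s) *: e + z).
have gdg (t : R) : 0 <= t <= 1 -> is_derive t 1 g (s * df ((t * s) *: e + z)).
  move=> t01; have /is_derive_scale /is_deriveP H := fdf t t01.
  apply/is_deriveP; apply: cvg_trans (H s); apply: near_eq_cvg.
  near=> h; rewrite /g /=; congr (_ *: (f _ - _)).
  by rewrite addrA !scalerA -scalerDl mulrDl -[(h *: 1)]/(h * 1) mulr1.
have [t t01 E] : exists2 t : R, t \in `[(0:R), 1] &
    g 1 - g 0 = s * df ((t * s) *: e + z) * (1 - 0).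
  apply: (MVT_segment (df := fun t : R => s * df ((t * s) *: e + z))) => //.
    move=> t; rewrite in_itv/= => /andP[t0 t1].
    by apply: gdg; rewrite !ltW.
  apply: derivable_within_continuous => t; rewrite in_itv/= => /gdg.
  by case.
exists t; first by move: t01; rewrite in_itv.
by move: E; rewrite /g mul1r mul0r scale0r add0r subr0 mulr1.
Unshelve. all: by end_near. Qed.

Lemma ball_rV_coord m (x y : 'rV[R]_m) r : 0 < r ->
  (forall j, `|y 0 j - x 0 j| < r) -> ball x r y.
Proof.
move=> r0 H; split=> // i j; rewrite ord1 -ball_normE /= distrC; exact: H.
Qed.

Lemma coord_ball_rV m (x y : 'rV[R]_m) r j :
  ball x r y -> `|y 0 j - x 0 j| < r.
Proof. by case=> _ /(_ 0 j); rewrite -ball_normE /= distrC. Qed.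

Lemma coord_le_norm m (x : 'rV[R]_m) j : `|x 0 j| <= `|x|.
Proof.
rewrite [leRHS]/Num.norm /= mx_normrE.
by rewrite (le_bigmax _ (fun ij : 'I_1 * 'I_m => `|x ij.1 ij.2|) (0, j)).
Qed.

Lemma norm_le_coord m (x : 'rV[R]_m) (e : R) : 0 <= e ->
  (forall j, `|x 0 j| <= e) -> `|x| <= e.
Proof.
move=> e0 H; rewrite [leLHS]/Num.norm /= mx_normrE.
by apply/bigmax_leP; split=> // -[i j] _ /=; rewrite ord1.
Qed.

(** Moving from [a] to [b] one coordinate at a time stays in the ball, since
    balls of the supremum norm are boxes. *)
Lemma mvt_coord m (f : 'rV[R]_m -> R) (df : 'I_m -> 'rV[R]_m -> R)
    (x : 'rV[R]_m) (r : R) (a b : 'rV[R]_m) : 0 < r ->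
  (forall j z, ball x r z -> is_derive z (delta_mx 0 j) f (df j z)) ->
  ball x r a -> ball x r b ->
  exists2 xi : 'I_m -> 'rV[R]_m, forall j, ball x r (xi j) &
    f b - f a = \sum_j (b - a) 0 j * df j (xi j).
Proof.
move=> r0 fdf xa xb.
pose z n : 'rV[R]_m := \row_i (if (i < n)%N then b 0 i else a 0 i).
have zS (j : 'I_m) t :
    (t * (b - a) 0 j) *: delta_mx 0 j + z j =
    \row_i (if i == j then t * b 0 j + (1 - t) * a 0 j else z j 0 i).
  apply/rowP => i; rewrite !mxE eqxx /=; case: eqVneq => [->|ij].
    by rewrite ltnn mulr1; ring.
  by rewrite mulr0 add0r.
have step (j : 'I_m) : exists2 xi, ball x r xi &
    f (z j.+1) - f (z j) = (b - a) 0 j * df j xi.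
  have xz t : 0 <= t <= 1 -> ball x r ((t * (b - a) 0 j) *: delta_mx 0 j + z j).
    move=> /andP[t0 t1]; rewrite zS; apply: ball_rV_coord => // i.
    rewrite mxE; case: eqVneq => [->|_]; last first.
      by rewrite mxE; case: ifP => _; exact: coord_ball_rV.
    have := coord_ball_rV j xa; have := coord_ball_rV j xb.
    rewrite !ltr_norml => /andP[b1 b2] /andP[a1 a2].
    have [t_eq0|t_neq0] := eqVneq t 0; first by rewrite t_eq0; lra.
    have t_gt0 : 0 < t by rewrite lt_def t_neq0.
    by apply/andP; split; nra.
  have [t t01 E] := @mvt_line _ f (df j) (z j) (delta_mx 0 j) ((b - a) 0 j)
    (fun t t01 => fdf j _ (xz t t01)).
  exists ((t * (b - a) 0 j) *: delta_mx 0 j + z j); first exact: xz.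
  rewrite -E; congr (f _ - _).
  rewrite -[X in X *: _ + _]mul1r zS; apply/rowP => i; rewrite !mxE ltnS.
  rewrite leq_eqVlt -val_eqE /=; case: eqVneq => //= /val_inj ->.
  by rewrite subrr mul0r addr0 mul1r.
have [xi Hxi] := choice (fun j => let: ex_intro2 xi p q := step j in
  ex_intro (fun xi => ball x r xi /\ f (z j.+1) - f (z j) = (b - a) 0 j * df j xi)
    xi (conj p q)).
exists xi => [j|]; first by case: (Hxi j).
have eb : z m = b by apply/rowP => i; rewrite mxE ltn_ord.
have ea : z 0%N = a by apply/rowP => i; rewrite mxE ltn0.
have /= := telescope_sumr (fun n => f (z n)) (leq0n m).
rewrite big_mkord eb ea => <-.
by apply: eq_bigr => j _; case: (Hxi j) => _ ->.
Qed.

Lemma C1_near m (U : set 'rV[R]_m) (f : 'rV[R]_m -> R) x (e : R) :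
  Cn_on 1 U f -> nbhs x U -> 0 < e ->
  exists2 r : R, 0 < r & forall z j, ball x r z ->
    is_derive z (delta_mx 0 j) f ('D_(delta_mx 0 j) f z) /\
    `|'D_(delta_mx 0 j) f x - 'D_(delta_mx 0 j) f z| < e.
Proof.
case=> _ /= dfU Ux e0.
pose P j := [set z | `|'D_(delta_mx 0 j) f x - 'D_(delta_mx 0 j) f z| < e].
have nP j : nbhs x (P j).
  have [_ [+ _]] := dfU j.
  by move=> /(_ x (nbhs_singleton Ux)) /cvgrPdist_lt; exact.
have /nbhs_ballP[r /= r0 H] : nbhs x ([set z | forall j, P j z] `&` U).
  by apply: filterI => //; exact: (@filter_forall _ _ P (nbhs x) (nbhs_filter x) nP).
exists r => // z j /H[Dz Uz]; split; last exact: Dz.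
by split=> //; have [+ _] := dfU j; exact.
Qed.

(** Partial derivatives that are continuous at [x] give the derivative in every
    direction, by [mvt_coord]. *)
Lemma is_derive_partials m (U : set 'rV[R]_m) (f : 'rV[R]_m -> R) x v :
  Cn_on 1 U f -> nbhs x U ->
  is_derive x v f (\sum_j v 0 j * 'D_(delta_mx 0 j) f x).
Proof.
move=> fU Ux; apply/is_deriveP/cvg_dnbhs0P => e e0.
pose M := \sum_j `|v 0 j| + 1.
have M0 : 0 < M by rewrite ltr_wpDl// sumr_ge0.
have [r r0 Hr] := C1_near fU Ux (divr_gt0 e0 M0).
have N0 : 0 < `|v| + 1 by rewrite ltr_wpDl.
exists (r / (`|v| + 1)) => [|h h0 hr]; first exact: divr_gt0.
have xhv := ball_line x hr.
have dfr j z : ball x r z -> is_derive z (delta_mx 0 j) f ('D_(delta_mx 0 j) f z).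
  by move=> /(Hr _ j)[].
have [xi xxi ->] := mvt_coord r0 dfr (ballxx x r0) xhv.
rewrite addrK scaler_sumr -sumrB.
apply: (@le_lt_trans _ _ (\sum_j `|v 0 j| * (e / M))).
  apply: le_trans (ler_norm_sum _ _ _) _; apply: ler_sum => j _.
  rewrite mxE -[_ *: _]/(_ * _) !mulrA mulVf// mul1r -mulrBr normrM.
  rewrite -[leRHS]mulrA; apply: ler_wpM2l => //; rewrite distrC; apply/ltW.
  by have [_] := Hr _ j (xxi j).
rewrite -mulr_suml mulrCA gtr_pMr// ltr_pdivrMr// mul1r.
by rewrite /M ltrDl.
Qed.

Lemma is_derive_rV (V : normedModType R) n (F : V -> 'rV[R]_n) (x v : V)
    (w : 'rV[R]_n) :
  (forall j, is_derive x v (fun u => F u 0 j) (w 0 j)) -> is_derive x v F w.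
Proof.
move=> FE; apply/is_deriveP/cvg_dnbhs0P => e e0.
have e2 : 0 < e / 2 by rewrite divr_gt0.
have /choice[r Hr] j : exists r : R, 0 < r /\ forall h, h != 0 -> `|h| < r ->
    `|h^-1 *: (F (h *: v + x) 0 j - F x 0 j) - w 0 j| < e / 2.
  have /is_deriveP/cvg_dnbhs0P/(_ _ e2)[r r0 H] := FE j; by exists r.
exists (\big[Num.min/1]_j r j) => [|h h0 /bigmin_gtP[_ hr]].
  by apply/bigmin_gtP; split=> // j _; case: (Hr j).
apply: (@le_lt_trans _ _ (e / 2)); last by rewrite ltr_pdivrMr// ltr_pMr// ltr1n.
apply: norm_le_coord => [|j]; first exact: ltW.
by rewrite !mxE; apply/ltW; have [_ /(_ h h0 (hr j isT))] := Hr j.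
Qed.

(** Again by [mvt_coord], the partial derivatives being bounded near [x]. *)
Lemma C1_lipschitz m (U : set 'rV[R]_m) (f : 'rV[R]_m -> R) x :
  Cn_on 1 U f -> nbhs x U ->
  exists r L : R, [/\ 0 < r, 0 <= L & forall a b, ball x r a -> ball x r b ->
    `|f a - f b| <= L * `|a - b|].
Proof.
move=> fU Ux; have [r r0 Hr] := C1_near fU Ux ltr01.
exists r, (\sum_j (`|'D_(delta_mx 0 j) f x| + 1)); split=> //.
  by rewrite sumr_ge0// => j _; rewrite addr_ge0.
move=> a b xa xb.
have dfr j z : ball x r z -> is_derive z (delta_mx 0 j) f ('D_(delta_mx 0 j) f z).
  by move=> /(Hr _ j)[].
have [xi xxi ->] := mvt_coord r0 dfr xb xa.
rewrite mulr_suml; apply: le_trans (ler_norm_sum _ _ _) _.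
apply: ler_sum => j _; rewrite normrM mulrC ler_pM// ?coord_le_norm//.
have [_ /ltW H] := Hr _ j (xxi j).
rewrite -[X in `|X|](subrK ('D_(delta_mx 0 j) f x)) addrC.
by apply: le_trans (ler_normD _ _) _; rewrite lerD2l distrC.
Qed.

Lemma is_derive_row_mxl m n (f : 'rV[R]_(m + n) -> R) (a v : 'rV[R]_m)
    (b : 'rV[R]_n) (l : R) :
  is_derive (row_mx a b) (row_mx v 0) f l ->
  is_derive a v (fun u => f (row_mx u b)) l.
Proof.
move=> /is_deriveP fl; apply/is_deriveP; apply: cvg_trans fl; apply: near_eq_cvg.
near=> h; congr (_ *: (f _ - _)).
by rewrite scale_row_mx add_row_mx scaler0 add0r.
Unshelve. all: by end_near. Qed.

Lemma is_derive_row_mxr m n (f : 'rV[R]_(m + n) -> R) (a : 'rV[R]_m)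
    (b v : 'rV[R]_n) (l : R) :
  is_derive (row_mx a b) (row_mx 0 v) f l ->
  is_derive b v (fun u => f (row_mx a u)) l.
Proof.
move=> /is_deriveP fl; apply/is_deriveP; apply: cvg_trans fl; apply: near_eq_cvg.
near=> h; congr (_ *: (f _ - _)).
by rewrite scale_row_mx add_row_mx scaler0 add0r.
Unshelve. all: by end_near. Qed.

Lemma delta_mx_lshift m n (i : 'I_m) :
  delta_mx 0 (lshift n i) = row_mx (delta_mx 0 i) 0 :> 'rV[R]_(m + n).
Proof.
apply/rowP => j; rewrite !mxE.
case: splitP => k jk; rewrite !mxE ?eqxx -!val_eqE /= jk //.
by rewrite gtn_eqF// (leq_trans (ltn_ord i)) ?leq_addr.
Qed.

Lemma delta_mx_rshift m n (i : 'I_n) :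
  delta_mx 0 (rshift m i) = row_mx 0 (delta_mx 0 i) :> 'rV[R]_(m + n).
Proof.
apply/rowP => j; rewrite !mxE.
case: splitP => k jk; rewrite !mxE ?eqxx -!val_eqE /= jk ?eqn_add2l //.
by rewrite ltn_eqF// (leq_trans (ltn_ord k)) ?leq_addr.
Qed.

Lemma ball_row_mx m n (a x : 'rV[R]_m) (b y : 'rV[R]_n) (r : R) : 0 < r ->
  ball x r a -> ball y r b -> ball (row_mx x y) r (row_mx a b).
Proof.
move=> r0 xa yb; apply: ball_rV_coord => // j; rewrite !mxE.
by case: splitP => k _; exact: coord_ball_rV.
Qed.

(** The mixed second difference of a C^2 function of two variables is the value
    of its mixed second derivatives at intermediate points: the coordinate mean
    value formula is used once in each variable. *)
Lemma second_difference m (U : set 'rV[R]_(m + m)) (f : 'rV[R]_(m + m) -> R)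
    (x : 'rV[R]_m) :
  Cn_on 2 U f -> nbhs (row_mx x x) U ->
  exists M : 'I_m -> 'I_m -> R, forall e : R, 0 < e -> exists2 r : R, 0 < r &
    forall a a' b b', ball x r a -> ball x r a' -> ball x r b -> ball x r b' ->
    exists N : 'I_m -> 'I_m -> R,
      (forall i j, `|N i j - M i j| < e) /\
      f (row_mx a b) - f (row_mx a' b) - f (row_mx a b') + f (row_mx a' b') =
      \sum_i \sum_j (a - a') 0 i * (b - b') 0 j * N i j.
Proof.
case=> f0 /= f2 Ux.
pose Df i := 'D_(delta_mx 0 (lshift m i)) f.
pose D2f i j := 'D_(delta_mx 0 (rshift m j)) (Df i).
have C1 i : Cn_on 1 U (Df i) by have [_] := f2 (lshift m i).
have C0 : Cn_on 1 U f.
  by split=> // i; have [df [cdf _]] := f2 i.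
exists (fun i j => D2f i j (row_mx x x)) => e e0.
have [r0 r0_gt0 Hr0] := C1_near C0 Ux e0.
have /choice[r1 Hr1] i : exists r : R, 0 < r /\
    forall z j, ball (row_mx x x) r z ->
    is_derive z (delta_mx 0 j) (Df i) ('D_(delta_mx 0 j) (Df i) z) /\
    `|'D_(delta_mx 0 j) (Df i) (row_mx x x) - 'D_(delta_mx 0 j) (Df i) z| < e.
  by have [r r_gt0 H] := C1_near (C1 i) Ux e0; exists r.
pose r := \big[Num.min/r0]_i r1 i.
have r_gt0 : 0 < r by apply/bigmin_gtP; split=> // i _; case: (Hr1 i).
exists r => // a a' b b' xa xa' xb xb'.
have ler0 : r <= r0 by exact: bigmin_le_id.
have ler1 i : r <= r1 i by exact: bigmin_le.
have d1 i z : ball x r z -> is_derive z (delta_mx 0 i)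
    (fun u => f (row_mx u b) - f (row_mx u b'))
    (Df i (row_mx z b) - Df i (row_mx z b')).
  move=> xz; apply: is_deriveB.
    apply: is_derive_row_mxl; rewrite -delta_mx_lshift; have [] := Hr0 (row_mx z b) (lshift m i) => //.
    by apply: le_ball ler0 _ _; exact: ball_row_mx.
  apply: is_derive_row_mxl; rewrite -delta_mx_lshift; have [] := Hr0 (row_mx z b') (lshift m i) => //.
  by apply: le_ball ler0 _ _; exact: ball_row_mx.
have [xi xxi E1] := mvt_coord r_gt0 d1 xa' xa.
have /choice[eta Heta] i : exists eta : 'I_m -> 'rV[R]_m,
    (forall j, ball x r (eta j)) /\
    Df i (row_mx (xi i) b) - Df i (row_mx (xi i) b') =
    \sum_j (b - b') 0 j * D2f i j (row_mx (xi i) (eta j)).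
  have d2 j z : ball x r z -> is_derive z (delta_mx 0 j)
      (fun w => Df i (row_mx (xi i) w)) (D2f i j (row_mx (xi i) z)).
    move=> xz; apply: is_derive_row_mxr; rewrite -delta_mx_rshift.
    have [_ /(_ (row_mx (xi i) z) (rshift m j))[]//] := Hr1 i.
    by apply: le_ball (ler1 i) _ _; exact: ball_row_mx.
  by have [eta xeta E] := mvt_coord r_gt0 d2 xb' xb; exists eta.
exists (fun i j => D2f i j (row_mx (xi i) (eta i j))); split.
  move=> i j; rewrite distrC; have [H _] := Heta i.
  have [_ /(_ (row_mx (xi i) (eta i j)) (rshift m j))[]//] := Hr1 i.
  by apply: le_ball (ler1 i) _ _; exact: ball_row_mx.
transitivity (f (row_mx a b) - f (row_mx a b') -
              (f (row_mx a' b) - f (row_mx a' b'))); first by ring.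
rewrite E1; apply: eq_bigr => i _; have [_ ->] := Heta i.
by rewrite mulr_sumr; apply: eq_bigr => j _; rewrite mulrA.
Qed.

End Calculus.

(** * Hilbert space geometry *)

Section Completeness.
Context {R : realType}.

Lemma cauchy_dnbhs0_cvg (W : completeNormedModType R) (g : R -> W) :
  (forall e : R, 0 < e -> exists2 r : R, 0 < r & forall s t, s != 0 -> t != 0 ->
    `|s| < r -> `|t| < r -> `|g s - g t| < e) ->
  exists l : W, g h @[h --> (0 : R)^'] --> l.
Proof.
move=> gC; have /cauchy_cvgP/cvg_ex// : cauchy (g @ (0 : R)^').
apply: cauchy_exP => e e0; have [r r0 H] := gC e e0.
have r2 : 0 < r / 2 by rewrite divr_gt0.
exists (g (r / 2)); apply/nbhs_ballP; exists r => //= h.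
rewrite -ball_normE /= sub0r normrN => hr h0.
rewrite -ball_normE /=; apply: H => //; first by rewrite gt_eqF.
by rewrite gtr0_norm// ltr_pdivrMr// ltr_pMr// ltr1n.
Qed.

End Completeness.

Section Hilbert.
Context {R : realType} {X : Type} {k : X -> X -> R} {H : completeNormedModType R}.
Variable HK : rkhs k H.
Implicit Types (f g h : H) (a : R).
Local Notation "'<<' f , g '>>'" := (rkhs_dot HK f g).

Lemma dotDl f g h : << f + g, h >> = << f, h >> + << g, h >>.
Proof. by rewrite -[f]scale1r rkhs_dotDl mul1r scale1r. Qed.

Lemma dot0l h : << 0, h >> = 0.
Proof. by apply: (addrI << 0, h >>); rewrite -dotDl !addr0. Qed.

Lemma dotZl a f h : << a *: f, h >> = a * << f, h >>.
Proof. by rewrite -[_ *: f]addr0 rkhs_dotDl dot0l addr0. Qed.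

Lemma dotBl f g h : << f - g, h >> = << f, h >> - << g, h >>.
Proof. by rewrite -scaleN1r dotDl dotZl mulN1r. Qed.

Lemma dotDr f g h : << h, f + g >> = << h, f >> + << h, g >>.
Proof. by rewrite rkhs_dotC dotDl ![<< h, _ >>]rkhs_dotC. Qed.

Lemma dotZr a f h : << h, a *: f >> = a * << h, f >>.
Proof. by rewrite rkhs_dotC dotZl [<< h, _ >>]rkhs_dotC. Qed.

Lemma dotBr f g h : << h, f - g >> = << h, f >> - << h, g >>.
Proof. by rewrite rkhs_dotC dotBl ![<< h, _ >>]rkhs_dotC. Qed.

Lemma dot_ge0 f : 0 <= << f, f >>.
Proof. by rewrite rkhs_dot_norm sqr_ge0. Qed.

Lemma norm_subE f g : `|f - g| ^+ 2 = << f, f >> - 2 * << f, g >> + << g, g >>.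
Proof.
rewrite -(rkhs_dot_norm HK) dotBl !dotBr [<< g, f >>]rkhs_dotC; ring.
Qed.

(** Expand the square norm of [<f, f> g - <f, g> f]. *)
Lemma cauchy_schwarz f g : `|<< f, g >>| <= `|f| * `|g|.
Proof.
have [->|f0] := eqVneq f 0; first by rewrite dot0l !normr0 mul0r.
rewrite -ler_sqr ?nnegrE ?mulr_ge0// exprMn real_normK ?num_real//.
rewrite -!(rkhs_dot_norm HK).
have ff : 0 < << f, f >> by rewrite rkhs_dot_norm exprn_gt0// normr_gt0.
have := dot_ge0 (<< f, f >> *: g - << f, g >> *: f).
rewrite dotBl !dotBr !dotZl !dotZr [<< g, f >>]rkhs_dotC => P.
have : 0 <= << f, f >> * (<< f, f >> * << g, g >> - << f, g >> ^+ 2) by nra.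
by rewrite pmulr_rge0// subr_ge0.
Qed.

Lemma dot_cvg (T : Type) (F : set_system T) {FF : Filter F} (f : T -> H) l g :
  f t @[t --> F] --> l -> << f t, g >> @[t --> F] --> << l, g >>.
Proof.
move=> /cvgrPdist_lt fl; apply/cvgrPdist_lt => e e0.
have g1 : 0 < `|g| + 1 by rewrite ltr_wpDl.
apply: filterS (fl _ (divr_gt0 e0 g1)) => t.
rewrite -dotBl => ft; apply: le_lt_trans (cauchy_schwarz _ _) _.
apply: (@le_lt_trans _ _ (`|l - f t| * (`|g| + 1))).
  by rewrite ler_wpM2l// lerDl.
by rewrite -ltr_pdivlMr.
Qed.

(** The representing vector minimises [|f|^2 - 2 Lam f]; by the parallelogram
    identity minimising families are Cauchy. *)
Lemma riesz_representation (Lam : H -> R) (C : R) :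
  (forall a f g, Lam (a *: f + g) = a * Lam f + Lam g) ->
  (forall f, `|Lam f| <= C * `|f|) ->
  exists v, forall f, Lam f = << f, v >>.
Proof.
move=> LL LC.
have LD f g : Lam (f + g) = Lam f + Lam g.
  by rewrite -[f in LHS]scale1r LL mul1r.
have L0 : Lam 0 = 0 by apply: (addrI (Lam 0)); rewrite -LD !addr0.
have LZ a f : Lam (a *: f) = a * Lam f by rewrite -[_ *: f]addr0 LL L0 addr0.
pose J f := << f, f >> - 2 * Lam f.
pose A := [set J f | f in [set: H]].
have Jlow f : - C ^+ 2 <= J f.
  have /ler_normlP[_ Lf] := LC f; have := sqr_ge0 (`|f| - C).
  by rewrite /J rkhs_dot_norm; nra.
have Ainf : has_inf A.
  split; first by exists (J 0), 0.
  by exists (- C ^+ 2) => _ [f _ <-].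
pose m := inf A.
have mJ f : m <= J f.
  by apply: ge_inf; [case: Ainf|exists f].
have near (e : R) : 0 < e -> exists f, J f < m + e.
  by move=> e0; have [_ [f _ <-] ?] := inf_adherent e0 Ainf; exists f.
have /choice[g Hg] (h : R) : exists f, h != 0 -> J f < m + `|h|.
  have [->|h0] := eqVneq h 0; first by exists 0.
  have [|f fm] := near `|h|; first by rewrite normr_gt0.
  by exists f.
(* parallelogram identity, with [m] bounding [J] below at the midpoint *)
have par f1 f2 : `|f1 - f2| ^+ 2 <= 2 * (J f1 - m) + 2 * (J f2 - m).
  have := mJ (2^-1 *: (f1 + f2)).
  rewrite norm_subE /J dotZl dotZr dotDl !dotDr LZ LD [<< f2, f1 >>]rkhs_dotC.
  lra.
have [|v gv] := @cauchy_dnbhs0_cvg _ _ g.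
  move=> e e0; exists (e ^+ 2 / 4) => [|s t s0 t0 sr tr].
    by rewrite divr_gt0// exprn_gt0.
  rewrite -ltr_sqr ?nnegrE// ?ltW//; apply: le_lt_trans (par _ _) _.
  have := Hg s s0; have := Hg t t0; lra.
exists v => f; apply/eqP; rewrite eq_sym -subr_eq0; apply/eqP.
set a := _ - _.
(* [J (v + t f) >= J v], written without evaluating [J] at [v] *)
have key t : 0 <= 2 * t * a + t ^+ 2 * << f, f >>.
  have cg : 2 * t * (<< g h, f >> - Lam f) + t ^+ 2 * << f, f >> + `|h|
      @[h --> (0 : R)^'] --> 2 * t * a + t ^+ 2 * << f, f >> + 0.
    apply: cvgD.
      apply: cvgD; last exact: cvg_cst.
      apply: cvgMr; apply: cvgB; last exact: cvg_cst.
      by rewrite [<< f, v >>]rkhs_dotC; exact: dot_cvg.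
    apply/cvg_dnbhs0P => e e0; exists e => // h h0 he.
    by rewrite subr0 normr_id.
  rewrite addr0 in cg; rewrite leNgt; apply/negP => neg.
  have /cvg_dnbhs0P/(_ (- (2 * t * a + t ^+ 2 * << f, f >>)))[] := cg.
    by rewrite oppr_gt0.
  move=> r r0 Hr; pose h := r / 2.
  have h_gt0 : 0 < h by rewrite divr_gt0.
  have h0 : h != 0 by rewrite gt_eqF.
  have /ltr_normlP[_] : `|2 * t * (<< g h, f >> - Lam f) + t ^+ 2 * << f, f >> + `|h| -
      (2 * t * a + t ^+ 2 * << f, f >>)| < - (2 * t * a + t ^+ 2 * << f, f >>).
    by apply: Hr; rewrite ?gtr0_norm// ltr_pdivrMr// ltr_pMr// ltr1n.
  have := mJ (g h + t *: f); have := Hg h h0.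
  rewrite /J dotDl !dotDr !dotZl !dotZr LD LZ [<< f, g h >>]rkhs_dotC.
  nra.
have ff := dot_ge0 f; have f1 : 0 < << f, f >> + 1 by rewrite ltr_wpDl.
(* adding 1 to the square norm avoids a separate treatment of [f = 0] *)
have := key (- a / (<< f, f >> + 1)); set N := << f, f >> in ff f1 *.
have -> : 2 * (- a / (N + 1)) * a + (- a / (N + 1)) ^+ 2 * N =
    - (a ^+ 2 * (N + 2) / (N + 1) ^+ 2) by field; rewrite gt_eqF.
rewrite oppr_ge0 => a_le0; apply/eqP; rewrite -sqrf_eq0 eq_le sqr_ge0 andbT.
have N2 : 0 < (N + 2) / (N + 1) ^+ 2 by rewrite divr_gt0 ?exprn_gt0// ltr_wpDl.
by move: a_le0; rewrite -mulrA pmulr_lle0.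
Qed.

End Hilbert.

(** * Measurability of limits in a real parameter *)

Section MeasurableLimit.
Context {d : measure_display} {T : measurableType d} {R : realType}.

Lemma invS_lt (e : R) : 0 < e -> exists n : nat, n.+1%:R^-1 < e.
Proof. by move=> e0; have [n] := ltr_add_invr e0; rewrite add0r; exists n. Qed.

(** Whether the limit exists is decided by a Cauchy condition over rational
    times, thanks to the continuity in time; where it fails, the chosen value
    does not depend on the point. *)
Lemma measurable_lim_dnbhs0 (D : set T) (q : R -> T -> R) : measurable D ->
  (forall t, t != 0 -> measurable_fun D (q t)) ->
  (forall x, D x -> exists2 r : R, 0 < r &
    forall t, t != 0 -> `|t| < r -> {for t, continuous (q ^~ x)}) ->
  measurable_fun D (fun x => lim (q t x @[t --> (0 : R)^'])).
Proof.
move=> mD mq cq.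
pose ok (M : nat) (s : R) := (s != 0) && (`|s| < M.+1%:R^-1).
pose B (N M : nat) (s t : R) : set T :=
  [set x | D x /\ (ok M s -> ok M t -> `|q s x - q t x| <= N.+1%:R^-1)].
(* [n] runs over codes of pairs of rational times; other codes impose nothing *)
pose A N M n : set T := if unpickle n is Some (a, b) then
  B N M (ratr (a : rat)) (ratr (b : rat)) else D.
pose E := D `&` \bigcap_N \bigcup_M \bigcap_n A N M n.
have mB N M s t : measurable (B N M s t).
  have [oks|noks] := boolP (ok M s); last first.
    rewrite (_ : B N M s t = D) //; apply/seteqP; split=> [x []//|x Dx].
    by split=> // oks; rewrite oks in noks.
  have [okt|nokt] := boolP (ok M t); last first.
    rewrite (_ : B N M s t = D) //; apply/seteqP; split=> [x []//|x Dx].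
    by split=> // _ okt; rewrite okt in nokt.
  have [s0 _] := andP oks; have [t0 _] := andP okt.
  have mst : measurable_fun D (fun x => `|q s x - q t x|).
    by apply: measurableT_comp => //; apply: measurable_funB; exact: mq.
  rewrite (_ : B N M s t =
      D `&` (fun x => `|q s x - q t x|) @^-1` `]-oo, N.+1%:R^-1]%classic).
    exact: mst.
  apply/seteqP; split=> x [Dx]; rewrite /= in_itv /=.
    by move=> /(_ oks okt).
  by move=> ?; split.
have mE : measurable E.
  apply: measurableI => //; apply: bigcapT_measurable => N.
  apply: bigcupT_measurable => M; apply: bigcapT_measurable => n.
  by rewrite /A; case: (unpickle n) => // -[a b].
have EP x : D x -> E x <-> exists l : R, q t x @[t --> (0 : R)^'] --> l.
  move=> Dx; split=> [[_ Ex]|[l /cvg_dnbhs0P ql]].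
    apply: cauchy_dnbhs0_cvg => e e0.
    have [N Ne] := invS_lt e0.
    have [M _ HM] := Ex N I.
    have [r r0 Hr] := cq x Dx.
    exists (Num.min r M.+1%:R^-1) => [|s t s0 t0]; first by rewrite lt_min r0 invr_gt0 ltr0n.
    rewrite !lt_min => /andP[sr sM] /andP[tr tM].
    apply: le_lt_trans Ne; apply/ler_addgt0Pr => eps eps0.
    have eps2 : 0 < eps / 2 by rewrite divr_gt0.
    have approx u : u != 0 -> `|u| < r -> `|u| < M.+1%:R^-1 -> exists a : rat,
        ok M (ratr a) /\ `|q (ratr a) x - q u x| < eps / 2.
      move=> u0 ur uM; have /cvg_nbhsP/(_ _ eps2)[r1 r1_gt0 Hr1] := Hr u u0 ur.
      pose r2 := Num.min r1 (Num.min `|u| (M.+1%:R^-1 - `|u|)).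
      have r2_gt0 : 0 < r2 by rewrite !lt_min r1_gt0 normr_gt0 u0 subr_gt0.
      have [a] : exists a : rat, ratr a \in `]u - r2, u + r2[.
        by apply: rat_in_itvoo; rewrite ltrBlDr -addrA ltrDl addr_gt0.
      rewrite in_itv /= -ltr_distl => ua; exists a; split; last first.
        apply: Hr1; rewrite -ball_normE /= distrC.
        by apply: lt_le_trans ua _; rewrite ge_min lexx.
      have u1 : `|ratr a - u| < `|u|.
        by apply: lt_le_trans ua _; rewrite !ge_min lexx orbT.
      have u2 : `|ratr a - u| < M.+1%:R^-1 - `|u|.
        by apply: lt_le_trans ua _; rewrite !ge_min lexx !orbT.
      apply/andP; split.
        by apply/eqP => a0; move: u1; rewrite a0 sub0r normrN ltxx.
      rewrite -[X in `|X|](subrK u); apply: le_lt_trans (ler_normD _ _) _.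
      by rewrite -ltrBrDr.
    have [a [oka qa]] := approx s s0 sr sM; have [b [okb qb]] := approx t t0 tr tM.
    have := HM (pickle (a, b)) I; rewrite /A pickleK => -[_ /(_ oka okb) qab].
    have -> : q s x - q t x = (q (ratr a) x - q (ratr b) x) -
        (q (ratr a) x - q s x) + (q (ratr b) x - q t x) by ring.
    apply: le_trans (ler_normD _ _) _.
    have := ler_normB (q (ratr a) x - q (ratr b) x) (q (ratr a) x - q s x).
    by move: qab; move: (N.+1%:R^-1) => y; lra.
  split=> // N _.
  have N2 : 0 < (N.+1%:R : R)^-1 / 2 by rewrite divr_gt0.
  have [r r0 Hr] := ql _ N2.
  have [M Mr] := invS_lt r0.
  exists M => // n _; rewrite /A; case: (unpickle n) => // -[a b].
  split=> // /andP[a0 aM] /andP[b0 bM].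
  have ha := Hr _ a0 (lt_trans aM Mr); have hb := Hr _ b0 (lt_trans bM Mr).
  rewrite -(subrKA l); apply: le_trans (ler_normD _ _) _.
  rewrite [`|l - _|]distrC; move: ha hb; move: (N.+1%:R^-1) => y; lra.
have DE : D = E `|` (D `\` E) by rewrite setDUK // => x [].
rewrite DE; apply/measurable_funU => //; first exact: measurableD.
split.
  apply: (measurable_fun_cvg (h := fun n => q n.+1%:R^-1)) => [n|x Ex].
    by apply: measurable_funS (mq _ _) => // x [].
  have [l ql] := (EP x Ex.1).1 Ex.
  have -> : lim (q t x @[t --> (0 : R)^']) = l by exact: cvg_lim.
  have /cvg_dnbhs0P H := ql; apply/cvgrPdist_lt => e e0; have [r r0 Hr] := H _ e0.
  have [M Mr] := invS_lt r0.
  exists M => // n /= Mn; rewrite distrC; apply: Hr => //.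
  rewrite gtr0_norm//; apply: le_lt_trans Mr.
  by rewrite lef_pV2 ?posrE// ler_nat.
apply: (eq_measurable_fun (fun=> get (set0 : set R))) => [x|]; last first.
  exact: measurable_cst.
rewrite inE => -[Dx nEx]; rewrite /lim /lim_in; congr (get _).
apply/seteqP; split=> // l ql; apply: nEx; apply/EP => //; by exists l.
Qed.

End MeasurableLimit.

(** * Bochner integrability *)

Section SimpleApproximation.
Context {d : measure_display} {T : measurableType d} {R : realType}
  {H : normedModType R}.

(** Greedy choice of the best among [0, h 0, .., h (n - 1)]; starting from [0]
    keeps the error below [`|F x|]. *)
Fixpoint best_approx (F : T -> H) (h : nat -> H) (n : nat) (x : T) : H :=
  if n is n'.+1 then
    if `|F x - h n'| < `|F x - best_approx F h n' x| then h n'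
    else best_approx F h n' x
  else 0.

Lemma best_approx_le F h n x : `|F x - best_approx F h n x| <= `|F x|.
Proof.
elim: n => [|n IH] /=; first by rewrite subr0.
by case: ifPn => // /ltW /le_trans; apply.
Qed.

Lemma best_approx_le_nth F h n i x : (i < n)%N ->
  `|F x - best_approx F h n x| <= `|F x - h i|.
Proof.
elim: n => // n IH; rewrite ltnS leq_eqVlt => /predU1P[->|/IH {}IH] /=.
  by case: ltP.
by case: ifPn => // /ltW /le_trans; apply.
Qed.

Lemma best_approx_cvg (F : T -> H) h x :
  (forall e : R, 0 < e -> exists i, `|F x - h i| < e) ->
  best_approx F h n x @[n --> \oo] --> F x.
Proof.
move=> dense; apply/cvgrPdist_lt => e /dense[i hi]; exists i.+1 => // n /= ni.
exact: le_lt_trans (best_approx_le_nth _ _ _ ni) hi.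
Qed.

Variables (F : T -> H) (h : nat -> H).
Hypothesis mF : forall v, measurable_fun setT (fun x => `|F x - v|).

Lemma best_approx_dist_measurable n :
  measurable_fun setT (fun x => `|F x - best_approx F h n x|).
Proof.
elim: n => [|n IH] /=; first exact: mF.
have -> : (fun x => `|F x - (if `|F x - h n| < `|F x - best_approx F h n x|
    then h n else best_approx F h n x)|) =
  (fun x => if `|F x - h n| < `|F x - best_approx F h n x| then `|F x - h n|
    else `|F x - best_approx F h n x|) by apply/funext => x; case: ifP.
by apply: measurable_fun_ifT => //; exact: measurable_fun_ltr.
Qed.

Lemma best_approx_fiber_measurable n v :
  measurable (best_approx F h n @^-1` [set v]).
Proof.
elim: n v => [|n IH] v.
  have [E|E] := pselect (0 = v :> H).
    by rewrite (_ : _ @^-1` _ = setT)//; apply/seteqP; split.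
  by rewrite (_ : _ @^-1` _ = set0)//; apply/seteqP; split.
pose C := [set x | `|F x - h n| < `|F x - best_approx F h n x|].
have mC : measurable C.
  rewrite -[C]setTI; apply: (measurable_fun_ltr (mF _) (best_approx_dist_measurable n)) => //.
rewrite (_ : _ @^-1` _ = (C `&` [set _ | h n = v]) `|`
  (~` C `&` best_approx F h n @^-1` [set v])).
  apply: measurableU; last exact/measurableI/IH/measurableC.
  have [E|E] := pselect (h n = v).
    by rewrite (_ : [set _ | _] = setT) ?setIT//; apply/seteqP; split.
  by rewrite (_ : [set _ | _] = set0) ?setI0//; apply/seteqP; split.
apply/seteqP; split=> x /=; rewrite /C /=; case: ifPn => [?|/negP ?].
- by left.
- by right.
- by case=> [] [].
- by case=> [] [].
Qed.

Lemma best_approx_finite_range n : finite_set (range (best_approx F h n)).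
Proof.
elim: n => [|n IH].
  by apply: (sub_finite_set (B := [set 0])) => // _ [x _ <-].
apply: (sub_finite_set (B := h n |` range (best_approx F h n))).
  by move=> _ [x _ <-] /=; case: ifP => _; [left|right; exists x].
by rewrite finite_setU; split.
Qed.

(** The errors of [best_approx] tend to zero pointwise and are dominated by the
    norm of [F]. *)
Lemma bochner_integrable_dense (m : {measure set T -> \bar R}) :
  (m setT < +oo)%E ->
  (forall x (e : R), 0 < e -> exists i, `|F x - h i| < e) ->
  (\int[m]_x `|F x|%:E < +oo)%E ->
  bochner_integrable m F.
Proof.
move=> mfin dense Ffin.
have sF n : simple_function m (best_approx F h n).
  split; first exact: best_approx_finite_range.
  move=> v; have mv := best_approx_fiber_measurable n v; split=> // _.
  by apply: le_lt_trans mfin; apply: le_measure; rewrite ?inE.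
have mnF : measurable_fun setT (fun x => `|F x|).
  by have := mF 0; under eq_fun do rewrite subr0.
split; exists (best_approx F h); split=> //.
  by apply: aeW => x; exact/best_approx_cvg/dense.
have iF : m.-integrable setT (fun x => `|F x|%:E).
  apply/integrableP; split; first exact/measurable_EFinP.
  by under eq_integral do rewrite gee0_abs ?lee_fin//.
pose D n x := `|F x - best_approx F h n x|%:E.
have mD n : measurable_fun setT (D n).
  by apply/measurable_EFinP; exact: best_approx_dist_measurable.
have D0 : {ae m, forall x, setT x -> D n x @[n --> \oo] --> 0%E}.
  apply: aeW => x _; apply: cvg_EFin; first exact: nearW.
  apply/cvgrPdist_lt => e e0; have /cvgrPdist_lt := best_approx_cvg (dense x).
  by move=> /(_ e e0); apply: filterS => n; rewrite sub0r normrN normr_id.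
have Dle : {ae m, forall x n, setT x -> (`|D n x| <= `|F x|%:E)%E}.
  by apply: aeW => x n _; rewrite abse_EFin normr_id lee_fin best_approx_le.
have [_ + _] := dominated_convergence measurableT mD (measurable_cst 0%E) D0 iF Dle.
rewrite /=; apply: cvg_trans; apply: near_eq_cvg; apply: nearW => n.
by apply: eq_integral => x _; rewrite subr0 normr_id.
Qed.

End SimpleApproximation.

(** * Measures with a density *)

Section Density.
Context {d : measure_display} {T : measurableType d} {R : realType}.
Variables (mu : {measure set T -> \bar R}) (q : T -> R).
Hypotheses (mq : measurable_fun setT q) (q0 : forall x, 0 <= q x).
Local Open Scope ereal_scope.

Let mEq : measurable_fun setT (EFin \o q). Proof. exact/measurable_EFinP. Qed.

(** [density_measure] is a bare set function; dominated convergence needs the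
    bundled measure. *)
Lemma density_measure_exists : exists nu : {measure set T -> \bar R},
  forall A, nu A = \int[mu]_(x in A) (q x)%:E.
Proof.
pose nu A := \int[mu]_(x in A) (q x)%:E.
have nu0 : nu set0 = 0 by rewrite /nu integral_set0.
have nu_ge0 A : 0 <= nu A by apply: integral_ge0 => x _; rewrite lee_fin.
have nu_add : semi_sigma_additive nu.
  by apply: semi_sigma_additive_nng_induced => // x; rewrite lee_fin.
pose mx := isMeasure.Build _ _ _ nu nu0 nu_ge0 nu_add.
pose nuM : {measure set T -> \bar R} := HB.pack nu mx.
by exists nuM.
Qed.

Import HBNNSimple.

(** Monotone approximation by simple functions reduces the identity to the
    defining one on sets. *)
Lemma integral_density (nu : {measure set T -> \bar R}) (f : T -> R) :
  (forall A, nu A = \int[mu]_(x in A) (q x)%:E) ->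
  measurable_fun setT f -> (forall x, (0 <= f x)%R) ->
  \int[nu]_x (f x)%:E = \int[mu]_x (f x * q x)%:E.
Proof.
move=> nuE mf f0.
have mEf : measurable_fun setT (EFin \o f) by exact/measurable_EFinP.
pose h := nnsfun_approx measurableT mEf.
have hf x : EFin (h n x) @[n --> \oo] --> (f x)%:E.
  by apply: cvg_nnsfun_approx => // y _; rewrite lee_fin.
have h_nd x : {homo (fun n => (h n x)%:E) : a b / (a <= b)%N >-> a <= b}.
  by move=> a b ab; rewrite lee_fin; exact/lefP/nd_nnsfun_approx.
have mh n : measurable_fun setT (EFin \o h n) by exact/measurable_EFinP.
transitivity (limn (fun n => \int[nu]_x (h n x)%:E)).
  rewrite -monotone_convergence//.
  - by apply: eq_integral => x _; apply/esym/cvg_lim => //; exact: hf.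
  - by move=> n x _; rewrite lee_fin.
transitivity (limn (fun n => \int[mu]_x ((h n x)%:E * (q x)%:E))); last first.
  rewrite -monotone_convergence//.
  - apply: eq_integral => x _; apply/cvg_lim => //; rewrite EFinM.
    by apply: cvgeZr => //; exact: hf.
  - by move=> n; apply: emeasurable_funM; [exact: mh|exact: mEq].
  - by move=> n x _; rewrite mule_ge0// lee_fin.
  - by move=> x _ a b ab; rewrite lee_wpmul2r ?lee_fin//; exact: h_nd.
congr (limn _); apply/funext => n; set g := h n.
have mI r : measurable (g @^-1` [set r]) by exact: measurable_sfunP.
have mrI r : measurable_fun setT (fun x => (r * \1_(g @^-1` [set r]) x)%:E).
  by apply/measurable_EFinP; apply: measurable_funM.
have rI0 r x : 0 <= (r * \1_(g @^-1` [set r]) x)%:E.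
  exact: nnfun_muleindic_ge0.
transitivity (\int[nu]_x
   (\sum_(r \in range g) (r * \1_(g @^-1` [set r]) x)%:E)).
  by apply: eq_integral => t _; rewrite fimfunE -fsumEFin.
rewrite ge0_integral_fsum//.
transitivity (\int[mu]_x (\sum_(r \in range g)
    ((r * \1_(g @^-1` [set r]) x)%:E * (q x)%:E))); last first.
  apply: eq_integral => x _; rewrite -ge0_mule_fsuml => [|r]; last exact: rI0.
  by rewrite fsumEFin // -fimfunE.
rewrite ge0_integral_fsum//; last 2 first.
  - by move=> r; exact: emeasurable_funM.
  - by move=> r x _; rewrite mule_ge0 ?rI0// lee_fin.
apply: eq_fsbigr => r rg.
rewrite integralZl_indic_nnsfun// integral_indic// setIT nuE.
under [RHS]eq_integral do rewrite EFinM -muleA.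
have r0 : 0 <= r%:E by move: rg; rewrite inE => -[x _ <-]; rewrite lee_fin.
rewrite ge0_integralZl//; last 2 first.
  - by apply: emeasurable_funM => //; exact/measurable_EFinP.
  - by move=> x _; rewrite mule_ge0// lee_fin.
congr (_ * _); rewrite -[in LHS](setTI (_ @^-1` _)) integral_mkcondr.
by apply: eq_integral => x _; rewrite muleC epatch_indic.
Qed.

End Density.

(** * Weak means of Hilbert space valued maps *)

Section WeakMean.
Context {R : realType} {X : Type} {k : X -> X -> R} {H : completeNormedModType R}.
Variable HK : rkhs k H.
Context {disp : measure_display} {T : measurableType disp}.
Implicit Types (f g h : H).
Local Notation "'<<' f , g '>>'" := (rkhs_dot HK f g).

Lemma polarization f g : << f, g >> = 4^-1 * (`|g + f| ^+ 2 - `|g - f| ^+ 2).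
Proof.
rewrite -!(rkhs_dot_norm HK) -(scaleN1r f) !dotDl !dotDr !dotZl !dotZr.
by rewrite [<< g, f >>]rkhs_dotC; field.
Qed.

Lemma dot_continuous (S : topologicalType) (F F' : S -> H) x :
  {for x, continuous F} -> {for x, continuous F'} ->
  {for x, continuous (fun y => << F y, F' y >>)}.
Proof.
move=> cF cF'.
have -> : (fun y => << F y, F' y >>) =
    (fun y => 4^-1 * (`|F' y + F y| ^+ 2 - `|F' y - F y| ^+ 2)).
  by apply/funext => y; rewrite polarization.
apply: cvgMr; apply: cvgB; rewrite expr2; apply: cvgM.
- by apply: cvg_norm; exact: cvgD.
- by apply: cvg_norm; exact: cvgD.
- by apply: cvg_norm; exact: cvgB.
- by apply: cvg_norm; exact: cvgB.
Qed.

Variables (mu : {measure set T -> \bar R}) (F : T -> H) (w : T -> R).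
Hypotheses (mF : forall v, measurable_fun setT (fun x => `|F x - v|))
  (mw : measurable_fun setT w) (w0 : forall x, 0 <= w x)
  (iF : mu.-integrable setT (fun x => (`|F x| * w x)%:E)).

(** By [polarization], distances to fixed vectors determine the pairings. *)
Lemma dot_measurable f : measurable_fun setT (fun x => << f, F x >>).
Proof.
under eq_fun do rewrite polarization.
apply: (measurable_funM (measurable_cst _)); apply: measurable_funB.
  apply: measurable_funX; have := mF (- f); by under eq_fun do rewrite opprK.
by apply: measurable_funX; exact: mF.
Qed.

Lemma dot_integrable f : mu.-integrable setT (fun x => (<< f, F x >> * w x)%:E).
Proof.
apply: (le_integrable measurableT _ _ (integrableZl measurableT `|f| iF)).
  by apply/measurable_EFinP; apply: measurable_funM => //; exact: dot_measurable.
move=> x _; rewrite -EFinM !abse_EFin lee_fin [leLHS]normrM (ger0_norm (w0 x)).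
by rewrite [leRHS]ger0_norm ?mulr_ge0// mulrA ler_wpM2r// cauchy_schwarz.
Qed.

(** The Bochner integral of [F] with respect to the measure of density [w]; only
    its pairings matter, so Riesz representation provides it. *)
Lemma weak_mean : exists m : H, forall f,
  (\int[mu]_x (<< f, F x >> * w x)%:E = << f, m >>%:E)%E.
Proof.
pose Lam f := (\int[mu]_x (<< f, F x >> * w x))%R.
have LamE f : (\int[mu]_x (<< f, F x >> * w x)%:E = (Lam f)%:E)%E.
  by rewrite /Lam /Rintegral fineK//; apply: integrable_fin_num => //; exact: dot_integrable.
have [||m Hm] := @riesz_representation R X k H HK Lam (\int[mu]_x (`|F x| * w x))%R.
- move=> a f g; rewrite /Lam -RintegralZl//; last exact: dot_integrable.
  rewrite -RintegralD//; last 2 first.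
  + have := integrableZl measurableT a (dot_integrable f).
    by apply: eq_integrable => // x _; rewrite -EFinM.
  + exact: dot_integrable.
  by apply: eq_Rintegral => x _; rewrite dotDl dotZl; ring.
- move=> f; rewrite /Lam.
  apply: le_trans (le_normr_Rintegral _ (dot_integrable f)) _ => //.
  rewrite mulrC -RintegralZl//; apply: le_Rintegral => //.
  + have := integrable_norm (dot_integrable f).
    by apply: eq_integrable => // x _.
  + have := integrableZl measurableT `|f| iF.
    by apply: eq_integrable => // x _; rewrite -EFinM.
  + move=> x _; rewrite normrM (ger0_norm (w0 x)) mulrA.
    by rewrite ler_wpM2r// cauchy_schwarz.
by exists m => f; rewrite LamE Hm.
Qed.

End WeakMean.

(** * Charts, multiplication and left-invariant derivatives *)

Section Curves.
Context {R : realType} {d : nat} {G : lieGroupType R d}.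
Implicit Types (x y a b : G).

Lemma chart_atK x y : chart_dom (chart_at x) y ->
  chart_inv (chart_at x) (chart_at x y) = y.
Proof. by move=> xy; apply: chart_funK; rewrite inE. Qed.

Lemma chart_atKx x : chart_inv (chart_at x) (chart_at x x) = x.
Proof. exact/chart_atK/chart_at_dom. Qed.

Lemma chart_cod_nbhs x : nbhs (chart_at x x) (chart_cod (chart_at x)).
Proof.
apply: open_nbhs_nbhs; split; first exact: chart_cod_open.
by exists x => //; exact: chart_at_dom.
Qed.

Lemma chart_inv_cvg x : chart_inv (chart_at x) u @[u --> chart_at x x] --> x.
Proof.
have H : {for chart_at x x, continuous (chart_inv (chart_at x))}.
  exact/chart_inv_continuous/(nbhs_singleton (chart_cod_nbhs x)).
by rewrite -[X in _ --> X]chart_atKx; exact: H.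
Qed.

Lemma chart_dom_nbhs x : nbhs x (chart_dom (chart_at x)).
Proof.
by apply: open_nbhs_nbhs; split; [exact: chart_dom_open|exact: chart_at_dom].
Qed.

Lemma mulg_cvg a b : (z.1 * z.2)%g @[z --> (a, b)] --> (a * b)%g.
Proof. exact: (@mulg_continuous G (a, b)). Qed.

Lemma lsubmx_continuous m n :
  continuous (fun w : 'rV[R]_(m + n) => lsubmx w).
Proof.
move=> z; apply/cvg_nbhsP => e e0; exists e => // w zw.
have : ball (lsubmx z) e (lsubmx w).
  by apply: ball_rV_coord => // j; rewrite !mxE; exact: coord_ball_rV.
by rewrite -ball_normE /= distrC.
Qed.

Lemma rsubmx_continuous m n :
  continuous (fun w : 'rV[R]_(m + n) => rsubmx w).
Proof.
move=> z; apply/cvg_nbhsP => e e0; exists e => // w zw.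
have : ball (rsubmx z) e (rsubmx w).
  by apply: ball_rV_coord => // j; rewrite !mxE; exact: coord_ball_rV.
by rewrite -ball_normE /= distrC.
Qed.

Definition mulg_chart a b (z : 'rV[R]_(d + d)) : 'rV[R]_d :=
  chart_at (a * b)%g
    (chart_inv (chart_at a) (lsubmx z) * chart_inv (chart_at b) (rsubmx z))%g.

Definition mulg_chart_dom a b : set 'rV[R]_(d + d) :=
  [set z | [/\ chart_cod (chart_at a) (lsubmx z),
    chart_cod (chart_at b) (rsubmx z) &
    chart_dom (chart_at (a * b)%g) (chart_inv (chart_at a) (lsubmx z) *
      chart_inv (chart_at b) (rsubmx z))%g]].

Lemma mulg_chart_smooth a b n j :
  Cn_on n (mulg_chart_dom a b) (fun z => mulg_chart a b z 0 j).
Proof. by apply: mulg_smooth; exact: chart_at_atlas. Qed.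

Lemma mulg_chart_dom_nbhs a b :
  nbhs (row_mx (chart_at a a) (chart_at b b)) (mulg_chart_dom a b).
Proof.
set z0 := row_mx _ _.
have cl : lsubmx w @[w --> z0] --> chart_at a a.
  by rewrite -(row_mxKl (chart_at a a) (chart_at b b)); exact: lsubmx_continuous.
have cr : rsubmx w @[w --> z0] --> chart_at b b.
  by rewrite -(row_mxKr (chart_at a a) (chart_at b b)); exact: rsubmx_continuous.
have nl := cl _ (chart_cod_nbhs a); have nr := cr _ (chart_cod_nbhs b).
have cm : (chart_inv (chart_at a) (lsubmx w) *
    chart_inv (chart_at b) (rsubmx w))%g @[w --> z0] --> (a * b)%g.
  apply: (cvg_comp2 (cvg_comp _ _ cl (@chart_inv_cvg a))
    (cvg_comp _ _ cr (@chart_inv_cvg b)) (h := fun y z : G => (y * z)%g)).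
  exact: mulg_cvg.
have nm := cm _ (chart_dom_nbhs (a * b)%g).
have Fz0 := nbhs_filter z0.
have H := (@filterI _ _ Fz0 _ _ nl (@filterI _ _ Fz0 _ _ nr nm)).
by apply: (@filterS _ _ Fz0 _ _ _ H) => w [? [? ?]]; split.
Qed.

Lemma mulg_chart_lipschitz a b : exists r L : R, [/\ 0 < r, 0 <= L &
  forall z w, ball (row_mx (chart_at a a) (chart_at b b)) r z ->
    ball (row_mx (chart_at a a) (chart_at b b)) r w ->
    mulg_chart_dom a b z /\ `|mulg_chart a b z - mulg_chart a b w| <= L * `|z - w|].
Proof.
set z0 := row_mx _ _.
have /nbhs_ballP[r0 /= r0_gt0 Hr0] := mulg_chart_dom_nbhs a b.
have /choice[r Hr] j : exists r : R, 0 < r /\ exists L : R, 0 <= L /\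
    forall z w, ball z0 r z -> ball z0 r w ->
    `|mulg_chart a b z 0 j - mulg_chart a b w 0 j| <= L * `|z - w|.
  have [r [L [? ? ?]]] := C1_lipschitz (mulg_chart_smooth a b 1 j)
    (mulg_chart_dom_nbhs a b).
  by exists r; split=> //; exists L.
have /choice[L HL] j := (Hr j).2.
exists (\big[Num.min/r0]_j r j), (\sum_j L j); split.
- by apply/bigmin_gtP; split=> // j _; case: (Hr j).
- by apply: sumr_ge0 => j _; case: (HL j).
move=> z w zr wr; split.
  by apply: Hr0; apply: le_ball zr; exact: bigmin_le_id.
apply: norm_le_coord => [|j].
  by rewrite mulr_ge0// sumr_ge0// => j _; case: (HL j).
rewrite !mxE; have [L0 /(_ z w)] := HL j.
move=> /(_ (le_ball _ zr) (le_ball _ wr)) H; apply: le_trans (H _ _) _.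
- exact: bigmin_le.
- exact: bigmin_le.
rewrite ler_wpM2r// (bigD1 j)//= lerDl sumr_ge0// => i _; by case: (HL i).
Qed.

Definition chart_lipschitz (W : normedModType R) (f : G -> W) x :=
  exists r L : R, [/\ 0 < r, 0 <= L & forall u v, ball (chart_at x x) r u ->
    ball (chart_at x x) r v -> `|f (chart_inv (chart_at x) u) -
      f (chart_inv (chart_at x) v)| <= L * `|u - v|].

(** Near [x] the values of [f] stay above [f x / 2], where [g] is Lipschitz. *)
Lemma chart_lipschitz_comp (f : G -> R) (g : R -> R) x (C : R) :
  0 <= C -> 0 < f x ->
  (forall a b : R, f x / 2 <= a -> f x / 2 <= b -> `|g a - g b| <= C * `|a - b|) ->
  chart_lipschitz f x -> chart_lipschitz (fun y => g (f y)) x.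
Proof.
move=> C0 fx0 gL [r [L [r0 L0 fL]]].
have L1 : 0 < L + 1 by rewrite ltr_wpDl.
pose r' := Num.min r (f x / 2 / (L + 1)).
exists r', (C * L); split.
- by rewrite lt_min r0 !divr_gt0.
- exact: mulr_ge0.
have low w : ball (chart_at x x) r' w ->
    ball (chart_at x x) r w /\ f x / 2 <= f (chart_inv (chart_at x) w).
  move=> bw; have bwr : ball (chart_at x x) r w.
    by apply: le_ball bw; rewrite ge_min lexx.
  have bw' : ball (chart_at x x) (f x / 2 / (L + 1)) w.
    by apply: le_ball bw; rewrite ge_min lexx orbT.
  split=> //; have := fL _ _ (ballxx _ r0) bwr; rewrite chart_atKx.
  move: bw'; rewrite -ball_normE /= => /ltW bw'.
  have : L * `|chart_at x x - w| <= f x / 2.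
    apply: le_trans (_ : (L + 1) * (f x / 2 / (L + 1)) <= _).
      by rewrite ler_pM// lerDl.
    by rewrite mulrCA divff ?gt_eqF// mulr1.
  move=> h1 /ler_normlP[_ h2]; lra.
move=> u v /low[bu fu] /low[bv fv]; apply: le_trans (gL _ _ fu fv) _.
by rewrite -mulrA ler_wpM2l//; exact: fL.
Qed.

(** The curve and the chart line with the same velocity are at distance [o(t)],
    hence so are the values of [f] along them. *)
Lemma lipschitz_curve_derive (W : normedModType R) (f : G -> W) x
    (c : R -> G) (v : 'rV[R]_d) (w : W) :
  chart_lipschitz f x ->
  (\forall t \near 0, chart_dom (chart_at x) (c t)) ->
  t^-1 *: (chart_at x (c t) - chart_at x x) @[t --> (0 : R)^'] --> v ->
  t^-1 *: (f (c t) - f x) @[t --> (0 : R)^'] --> w <->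
  is_derive (chart_at x x) v (f \o chart_inv (chart_at x)) w.
Proof.
move=> [r [L [r0 L0 fL]]] /nbhs_ballP[r1 /= r1_gt0 cx] /cvg_dnbhs0P cv.
pose q (t : R) := t^-1 *: (f (c t) - f x).
pose q' (t : R) := t^-1 *: ((f \o chart_inv (chart_at x)) (t *: v + chart_at x x) -
   (f \o chart_inv (chart_at x)) (chart_at x x)).
have qq' : q t - q' t @[t --> (0 : R)^'] --> (0 : W).
  apply/cvg_dnbhs0P => e e0.
  have L1 : 0 < L + 1 by rewrite ltr_wpDl.
  have [r2 r2_gt0 H2] := cv _ (divr_gt0 e0 L1).
  have [r3 r3_gt0 H3] := cv _ ltr01.
  have N0 : 0 < `|v| + 1 by rewrite ltr_wpDl.
  pose rr := Num.min (Num.min r1 r2) (Num.min r3 (r / (`|v| + 1))).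
  exists rr => [|t t0]; first by rewrite !lt_min r1_gt0 r2_gt0 r3_gt0 divr_gt0.
  rewrite !lt_min => /andP[/andP[tr1 tr2] /andP[tr3 tr]].
  have tn0 : 0 < `|t| by rewrite normr_gt0.
  have b1 := ball_line (chart_at x x) tr.
  rewrite ltr_pdivlMr// in tr.
  have b2 : ball (chart_at x x) r (chart_at x (c t)).
    rewrite -ball_normE /= distrC.
    have -> : chart_at x (c t) - chart_at x x =
        t *: (t^-1 *: (chart_at x (c t) - chart_at x x)).
      by rewrite scalerA divff// scale1r.
    rewrite normrZ; apply: le_lt_trans tr; rewrite ler_wpM2l//.
    rewrite -[X in `|X|](subrK v) addrC; apply: le_trans (ler_normD _ _) _.
    by rewrite lerD2l ltW// H3.
  rewrite subr0 /q /q' -scalerBr /= chart_atKx opprB addrA subrK.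
  have ct : chart_dom (chart_at x) (c t).
    by apply: cx; rewrite -ball_normE /= sub0r normrN.
  rewrite -{1}(chart_atK ct).
  rewrite normrZ normfV mulrC ltr_pdivrMr//.
  apply: le_lt_trans (fL _ _ b2 b1) _.
  have -> : chart_at x (c t) - (t *: v + chart_at x x) =
      t *: (t^-1 *: (chart_at x (c t) - chart_at x x) - v).
    by rewrite scalerBr scalerA divff// scale1r opprD addrA addrAC.
  rewrite normrZ mulrCA mulrC ltr_pM2r//.
  apply: (@le_lt_trans _ _ (L * (e / (L + 1)))).
    by apply/ler_wpM2l/ltW/H2.
  by rewrite mulrCA gtr_pMr// ltr_pdivrMr// mul1r ltrDl.
split=> [qw|/is_deriveP q'w].
  apply/is_deriveP; rewrite -[w]subr0; apply: cvg_trans (cvgB qw qq').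
  by apply: near_eq_cvg; apply: nearW => t; rewrite /q /q' /= opprB addrC subrK.
rewrite -[w]add0r; apply: cvg_trans (cvgD qq' q'w).
by apply: near_eq_cvg; apply: nearW => t; rewrite /q /q' /= subrK.
Qed.

Local Notation eG := (1%g : G).

Definition chart_line (v : 'rV[R]_d) (t : R) : G :=
  chart_inv (chart_at eG) (t *: v + chart_at eG eG).

Lemma chart_line0 v : chart_line v 0 = 1%g.
Proof. by rewrite /chart_line scale0r add0r chart_atKx. Qed.

Lemma chart_line_near v (P : set 'rV[R]_d) : nbhs (chart_at eG eG) P ->
  exists2 r : R, 0 < r & forall t, `|t| < r -> P (t *: v + chart_at eG eG).
Proof.
move=> /nbhs_ballP[r /= r0 rP].
have N0 : 0 < `|v| + 1 by rewrite ltr_wpDl.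
exists (r / (`|v| + 1)) => [|t]; first exact: divr_gt0.
by move=> tr; apply: rP; exact: ball_line.
Qed.

Lemma chart_line_continuous v : exists2 r : R, 0 < r &
  forall t, `|t| < r -> {for t, continuous (chart_line v)}.
Proof.
have [r r0 Hr] := chart_line_near v (chart_cod_nbhs eG).
exists r => // t /Hr /chart_inv_continuous ct.
apply: (@continuous_comp _ _ _ (fun t : R => t *: v + chart_at eG eG)) => //.
apply: cvgD; last exact: cvg_cst.
by apply: cvgZr_tmp; exact: cvg_id.
Qed.

(** Left invariance between the identity and [x]; the derivative in its definition
    is an actual limit, because multiplication is smooth in charts. *)
Lemma left_invariant_velocity (X : G -> 'rV[R]_d) x : left_invariant X ->
  t^-1 *: (chart_at x (x * chart_line (X eG) t)%g - chart_at x x)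
    @[t --> (0 : R)^'] --> X x.
Proof.
move=> /(_ x 1%g) Xx.
pose F u := chart_at (x * 1)%g (x * chart_inv (chart_at eG) u)%g.
pose w : 'rV[R]_d := \row_k \sum_j (row_mx 0 (X eG) : 'rV[R]_(d + d)) 0 j *
  'D_(delta_mx 0 j) (fun z => mulg_chart x 1%g z 0 k)
     (row_mx (chart_at x x) (chart_at eG eG)).
have Fw : is_derive (chart_at eG eG) (X eG) F w.
  apply: is_derive_rV => k; rewrite mxE.
  have -> : (fun u => F u 0 k) =
      (fun u => mulg_chart x 1%g (row_mx (chart_at x x) u) 0 k).
    by apply/funext => u; rewrite /mulg_chart row_mxKl row_mxKr chart_atKx.
  apply: (is_derive_row_mxr (f := fun z => mulg_chart x 1%g z 0 k)).
  apply: is_derive_partials; last exact: mulg_chart_dom_nbhs.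
  exact: mulg_chart_smooth.
have {}Xx : X x = w.
  by rewrite -[in LHS](mulg1 x) Xx /tangent_map; case: Fw => _ <-.
move: Fw => /is_deriveP; rewrite -Xx /F chart_atKx mulg1; exact.
Qed.

Lemma mulg_chart_line_near x v :
  \forall t \near 0, chart_dom (chart_at x) (x * chart_line v t)%g.
Proof.
have [r r0 cr] := chart_line_continuous v.
have c0 : chart_line v t @[t --> 0] --> eG.
  by rewrite -(chart_line0 v); apply: cr; rewrite normr0.
have : (x * chart_line v t)%g @[t --> 0] --> x.
  rewrite -[X in _ --> X]mulg1.
  by apply: (cvg_comp2 (cvg_cst x) c0 (h := fun y z : G => (y * z)%g)); exact: mulg_cvg.
by apply; exact: chart_dom_nbhs.
Qed.

Lemma left_invariant_derive (W : normedModType R) (f : G -> W) X x (w : W) :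
  left_invariant X -> chart_lipschitz f x ->
  t^-1 *: (f (x * chart_line (X eG) t)%g - f x) @[t --> (0 : R)^'] --> w <->
  is_derive (chart_at x x) (X x) (f \o chart_inv (chart_at x)) w.
Proof.
move=> LX fx; apply: lipschitz_curve_derive => //.
  exact: mulg_chart_line_near.
exact: left_invariant_velocity.
Qed.

(** Both sides are defined by the same choice among the limits, so the equality
    holds whether or not the derivative exists. *)
Lemma vf_apply_lim (f : G -> R) X x :
  left_invariant X -> chart_lipschitz f x ->
  vf_apply X f x =
  lim (t^-1 *: (f (x * chart_line (X eG) t)%g - f x) @[t --> (0 : R)^']).
Proof.
move=> LX fx; rewrite /vf_apply /tangent_map /derive /lim /lim_in.
congr (get _); apply/funext => w; apply/propext.
split=> [/is_deriveP|fw]; first by move/left_invariant_derive; apply.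
by apply/is_deriveP/left_invariant_derive.
Qed.

End Curves.

(** * Haar measure on open sets *)

Section Borel.
Context {R : realType} {d : nat} {G : lieGroupType R d}.
Implicit Types (x y a b : G) (A O : set G).

Lemma open_borel O : open O -> measurable (O : set (borel G)).
Proof. by move=> oO; exact: sub_sigma_algebra. Qed.

Lemma open_continuous_borel O (f : G -> R) : open O ->
  (forall x, O x -> {for x, continuous f}) ->
  measurable_fun (O : set (borel G)) (f : borel G -> R).
Proof.
move=> oO cf _; apply: (measurability _ (RGenOpens.measurableE R)); last exact: open_borel.
move=> _ [_ [a [b ->]] <-]; apply: open_borel.
rewrite openE => x [Ox fx]; apply: filterI; first exact: open_nbhs_nbhs.
by apply: (cf _ Ox); apply: open_nbhs_nbhs; split; [exact: interval_open|].
Qed.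

Lemma continuous_borel (f : G -> R) : continuous f ->
  measurable_fun [set: borel G] (f : borel G -> R).
Proof.
move=> cf; apply: (@open_continuous_borel setT) => [|x _]; last exact: cf.
exact: openT.
Qed.

Lemma mulg_right_continuous a : continuous (fun y => (y * a)%g).
Proof.
move=> y; apply: (cvg_comp2 (cvg_id (F := nbhs y)) (cvg_cst a)
  (h := fun y z : G => (y * z)%g)).
exact: mulg_cvg.
Qed.

Lemma mulg_left_continuous a : continuous (fun y => (a * y)%g).
Proof.
move=> y; apply: (cvg_comp2 (cvg_cst a) (cvg_id (F := nbhs y))
  (h := fun y z : G => (y * z)%g)).
exact: mulg_cvg.
Qed.

Lemma open_left_translate a O : open O -> open ((fun y => (a * y)%g) @` O).
Proof.
move=> oO; have -> : (fun y => (a * y)%g) @` O = (fun y => (a^-1 * y)%g) @^-1` O.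
  apply/seteqP; split=> [_ [z Oz <-]|z Oz] /=; first by rewrite mulgA mulVg mul1g.
  by exists (a^-1 * z)%g => //; rewrite mulgA mulgV mul1g.
by apply: open_comp => // z _; exact: mulg_left_continuous.
Qed.

Lemma mulg_right_borel a :
  measurable_fun [set: borel G] (fun y : borel G => (y * a)%g : borel G).
Proof.
move=> mT; apply: (@measurability _ _ (borel G) (borel G) setT _ (@open G) _ _ mT).
  by [].
move=> _ [B oB <-]; rewrite setTI.
by apply: open_borel; apply: open_comp => // x _; exact: mulg_right_continuous.
Qed.

Lemma countable_basis : exists U : nat -> set G, (forall n, open (U n)) /\
  forall x O, nbhs x O -> exists2 n, U n x & U n `<=` O.
Proof.
have [B cB [Bo Bb]] := @lie_second_countable _ _ G.
move/pfcard_geP: cB => [B0|[u]].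
  rewrite B0 in Bb; by have /(Bb point) [V [[]]] := @filterT _ _ (nbhs_filter (point : G)).
exists u; split=> [n|x O /(Bb x)[V [BV Vx] VO]].
  by apply: Bo; exact: (@funS _ _ _ _ u).
have [n _ un] := @surj _ _ _ _ u V BV.
by exists n; rewrite un.
Qed.

End Borel.

Section Haar.
Context {R : realType} {d : nat} {G : lieGroupType R d}.
Variables (mu : {measure set (borel G) -> \bar R}) (haar : left_haar mu).
Implicit Types (x y a b : G).

(** Countably many left translates of a nonempty open set cover the group. *)
Lemma haar_open_gt0 (O : set G) x : open O -> O x -> (0 < mu (O : set (borel G)))%E.
Proof.
move=> oO Ox; rewrite lt0e measure_ge0 andbT; apply/negP => /eqP muO.
case: haar => inv _ /eqP; apply.
have [U [Uo Ub]] := @countable_basis R d G.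
(* only the basic sets covered by a translate of [O] are kept; they are null,
   because [O] is assumed to be *)
pose tr (g : G) : set (borel G) := (fun x : G => (g * x)%g) @` O.
pose V n : set (borel G) := if asbool (exists g, U n `<=` tr g) then U n else set0.
suff : mu.-negligible [set: borel G].
  by move=> /negligibleP; apply.
apply: (@negligibleS _ _ _ mu (\bigcup_n V n)).
  move=> y _; pose g := (y * x^-1)%g.
  have : nbhs y (tr g).
    apply: open_nbhs_nbhs; split; first exact: open_left_translate.
    by exists x => //; rewrite /g -mulgA mulVg mulg1.
  move=> /Ub[n Un Utr]; exists n => //; rewrite /V; case: asboolP => // H.
  by exfalso; apply: H; exists g.
apply: negligible_bigcup => n; rewrite /V; case: asboolP => [[g Ug]|_]; last exact: negligible_set0.
have mO : measurable (O : set (borel G)) by exact: open_borel.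
exists (tr g); split => //; last by rewrite inv.
by apply: open_borel; exact: open_left_translate.
Qed.

Definition chart_ball x (r : R) : set G :=
  [set y | chart_dom (chart_at x) y /\ ball (chart_at x x) r (chart_at x y)].

Lemma chart_ball_open x r : open (chart_ball x r).
Proof.
rewrite openE => y [dy By].
have cy : {for y, continuous (chart_at x)} by exact: chart_fun_continuous.
apply: filterI; first by apply: open_nbhs_nbhs; split=> //; exact: chart_dom_open.
apply: cy; move: By; rewrite -ball_normE /= => By.
apply/nbhs_ballP; exists (r - `|chart_at x x - chart_at x y|); first by rewrite /= subr_gt0.
move=> u; rewrite -ball_normE /= ltrBrDl; apply: le_lt_trans.
by rewrite -(subrKA (chart_at x y)) ler_normD.
Qed.

Lemma chart_ball_compact x : exists2 r : R, 0 < r &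
  exists2 K : set G, compact K & chart_ball x r `<=` K.
Proof.
have /nbhs_ballP[r /= r0 Hr] := chart_cod_nbhs x.
pose B : set 'rV[R]_d :=
  [set u | forall i, (fun i => `[chart_at x x 0 i - r / 2, chart_at x x 0 i + r / 2]%classic) i (u ord0 i)].
have cB : compact B by apply: rV_compact => i; exact: segment_compact.
exists (r / 2); first by rewrite divr_gt0.
exists (chart_inv (chart_at x) @` B).
  apply: continuous_compact cB; apply: continuous_in_subspaceT => u.
  rewrite inE => Bu; apply: chart_inv_continuous; apply: Hr.
  apply: ball_rV_coord => // j; apply: (@le_lt_trans _ _ (r / 2)).
    by have := Bu j; rewrite /= in_itv /= ler_distl.
  by rewrite ltr_pdivrMr// ltr_pMr// ltr1n.
move=> y [dy By]; exists (chart_at x y); last exact: chart_atK.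
by move=> i; rewrite /= in_itv /= -ler_distl; exact/ltW/coord_ball_rV.
Qed.

Lemma haar_chart_ball_fin x : exists2 r : R, 0 < r &
  forall s : R, s <= r -> (mu (chart_ball x s : set (borel G)) < +oo)%E.
Proof.
have [r r0 [K cK rK]] := chart_ball_compact x; exists r => // s sr.
case: haar => _ /(_ K cK) + _; apply: le_lt_trans.
have mK : measurable (K : set (borel G)).
  rewrite -[X in measurable X]setCK; apply: measurableC; apply: open_borel.
  apply: closed_openC; apply: compact_closed => //.
  exact: (@lie_hausdorff R d G).
have mB : measurable (chart_ball x s : set (borel G)).
  by apply: open_borel; exact: chart_ball_open.
apply: le_measure; rewrite ?inE// => y [dy By].
by apply: rK; split=> //; exact: le_ball By.
Qed.

End Haar.

(** * Regularity of the modular function *)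

Section Modular.
Context {R : realType} {d : nat} {G : lieGroupType R d}.
Variables (mu : {measure set (borel G) -> \bar R}) (haar : left_haar mu).
Variables (Delta : G -> R) (modular : modular_function mu Delta).
Implicit Types (x y a b : G).

(** A bump around [x] that is positive exactly on a chart ball and 1-Lipschitz in
    the chart. *)
Definition tent x (rho : R) (y : borel G) : R :=
  if y \in chart_ball x rho then rho - `|chart_at x y - chart_at x x| else 0.

Lemma tent_ge0 x rho y : 0 <= tent x rho y.
Proof.
rewrite /tent; case: ifPn => //; rewrite inE => -[_].
by rewrite -ball_normE /= distrC subr_ge0 => /ltW.
Qed.

Lemma tent_measurable x rho : measurable_fun setT (tent x rho).
Proof.
have mB : measurable (chart_ball x rho : set (borel G)).
  by apply: open_borel; exact: chart_ball_open.
have eB : (fun y : borel G => y \in chart_ball x rho) @^-1` [set true] =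
    chart_ball x rho.
  by apply/seteqP; split => y /=; [move/set_mem|move/mem_set].
apply: measurable_fun_if => //.
  by apply: (measurable_fun_bool true); rewrite setTI eB.
rewrite setTI eB; apply: open_continuous_borel; first exact: chart_ball_open.
move=> y [dy _]; apply: cvgB; first exact: cvg_cst.
apply: cvg_norm; apply: cvgB; last exact: cvg_cst.
exact: chart_fun_continuous.
Qed.

(** The image of the measure under [y |-> y a] is its multiple by the inverse of
    [Delta a], since [S = (S a^-1) a]. *)
Lemma integral_tent_mulg x rho a :
  (\int[mu]_y (tent x rho (y * a)%g)%:E =
   (Delta a)^-1%:E * \int[mu]_y (tent x rho y)%:E)%E.
Proof.
have [D0 DE] := modular.
have Da0 : 0 <= (Delta a)^-1 by rewrite invr_ge0 ltW.
transitivity (\int[pushforward mu (fun y : borel G => (y * a)%g : borel G)]_y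
    (tent x rho y)%:E)%E.
  rewrite [RHS]ge0_integral_pushforward//.
  - exact: (@mulg_right_borel R d G a).
  - by apply/measurable_EFinP; exact: tent_measurable.
  - by move=> y _; rewrite lee_fin tent_ge0.
rewrite (eq_measure_integral (mscale (NngNum Da0) mu)).
  rewrite ge0_integral_mscale//.
  - by apply/measurable_EFinP; exact: tent_measurable.
  - by move=> y _; rewrite lee_fin tent_ge0.
- exact: (@mulg_right_borel R d G a).
move=> mt A mA _; rewrite /mscale /pushforward /=.
have mB : measurable ((fun y : borel G => (y * a)%g : borel G) @^-1` A).
  by rewrite -[X in measurable X]setTI; exact: (@mulg_right_borel R d G a).
have := DE a _ mB.
have -> : (fun x : G => (x * a)%g) @` ((fun y : borel G => (y * a)%g : borel G) @^-1` A) = A.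
  apply/seteqP; split=> [_ [y Ay <-]//|y Ay].
  by exists (y * a^-1)%g; rewrite /= -mulgA mulVg mulg1.
move=> muA; change (mu ((fun y : borel G => (y * a)%g : borel G) @^-1` A) =
  ((Delta a)^-1%:E * mu A)%E).
by rewrite muA muleA -EFinM mulVf ?mul1e// gt_eqF.
Qed.

Lemma integral_tent_gt0 x (rho : R) : 0 < rho ->
  (0 < \int[mu]_y (tent x rho y)%:E)%E.
Proof.
move=> rho0; have rho2 : 0 < rho / 2 by rewrite divr_gt0.
have mB : measurable (chart_ball x (rho / 2) : set (borel G)).
  by apply: open_borel; exact: chart_ball_open.
apply: (@lt_le_trans _ _ ((rho / 2)%:E * mu (chart_ball x (rho / 2) : set (borel G)))%E).
  rewrite mule_gt0// ?lte_fin//; apply: (haar_open_gt0 haar (x := x)).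
    exact: chart_ball_open.
  by split; [exact: chart_at_dom|exact: ballxx].
rewrite -[X in mu X]setIT -integral_indic// -ge0_integralZl//; first last.
- by rewrite lee_fin ltW.
- by apply/measurable_EFinP; exact: measurable_indic.
apply: ge0_le_integral => //.
- by move=> y _; rewrite -EFinM lee_fin mulr_ge0// ltW.
- apply: measurable_funeM; apply/measurable_EFinP; exact: measurable_indic.
- by apply/measurable_EFinP; exact: tent_measurable.
move=> y _; rewrite -EFinM lee_fin indicE; case: (boolP (y \in _)); last first.
  by rewrite mulr0 tent_ge0.
rewrite inE mulr1 => -[dy By].
have yrho : chart_ball x rho y.
  by split=> //; apply: le_ball By; rewrite ler_pdivrMr// ler_pMr// ler1n.
rewrite /tent mem_set//.
move: By; rewrite -ball_normE /= distrC; lra.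
Qed.

Lemma integral_tent_fin x : exists2 r : R, 0 < r & forall rho, rho <= r ->
  (\int[mu]_y (tent x rho y)%:E < +oo)%E.
Proof.
have [r r0 Hr] := haar_chart_ball_fin haar x; exists r => // rho rr.
have [rho0|rho0] := leP rho 0.
  rewrite integral0_eq// => y _; rewrite /tent; case: ifPn => //.
  rewrite inE => -[_]; rewrite -ball_normE /= => /(le_lt_trans (normr_ge0 _)).
  by rewrite ltNge rho0.
have mB : measurable (chart_ball x rho : set (borel G)).
  by apply: open_borel; exact: chart_ball_open.
apply: (@le_lt_trans _ _ (rho%:E * mu (chart_ball x rho : set (borel G)))%E).
  rewrite -[X in mu X]setIT -integral_indic// -ge0_integralZl//; first last.
  - by rewrite lee_fin ltW.
  - by apply/measurable_EFinP; exact: measurable_indic.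
  apply: ge0_le_integral => //.
  - by move=> y _; rewrite lee_fin tent_ge0.
  - by apply/measurable_EFinP; exact: tent_measurable.
  - apply: measurable_funeM; apply/measurable_EFinP; exact: measurable_indic.
  move=> y _; rewrite -EFinM lee_fin indicE /tent.
  by case: (y \in _); rewrite ?mulr0// mulr1 gerBl.
by rewrite lte_mul_pinfty// ?lee_fin ?ltW//; exact: Hr.
Qed.

(** By [integral_tent_mulg] it suffices that the integral of [tent x rho (y a)]
    over [y] is Lipschitz in [a] near [x]. The integrand is, by
    [mulg_chart_lipschitz], and it vanishes for [y] outside a set [V] of finite
    measure around the identity. *)
Lemma modular_inv_lipschitz x : chart_lipschitz (fun a => (Delta a)^-1) x.
Proof.
pose e : G := 1%g.
have [r2 [L [r2_gt0 L0 HL]]] := mulg_chart_lipschitz e x.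
have [r1' r1'_gt0 Hfin] := haar_chart_ball_fin haar e.
pose r1 := Num.min r1' r2.
have r1_gt0 : 0 < r1 by rewrite lt_min r1'_gt0.
pose V := chart_ball e r1.
have Vfin : (mu (V : set (borel G)) < +oo)%E by apply: Hfin; rewrite ge_min lexx.
have mV : measurable (V : set (borel G)) by apply: open_borel; exact: chart_ball_open.
have nV : nbhs e V.
  apply: open_nbhs_nbhs; split; first exact: chart_ball_open.
  by split; [exact: chart_at_dom|exact: ballxx].
(* a product lying near x, with right factor near x, has its left factor in V *)
have [rho [r3 [rho_gt0 r3_gt0 H3]]] : exists rho r3 : R, [/\ 0 < rho, 0 < r3 &
    forall y u, chart_ball x rho (y * chart_inv (chart_at x) u)%g ->
    ball (chart_at x x) r3 u -> V y].
  have cdiv : (z.1 * (chart_inv (chart_at x) z.2)^-1)%g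
      @[z --> (x, chart_at x x)] --> e.
    have c1 : z.1 @[z --> (x, chart_at x x)] --> x by exact: cvg_fst.
    have c2 : z.2 @[z --> (x, chart_at x x)] --> chart_at x x by exact: cvg_snd.
    have c3 := cvg_comp _ _ (cvg_comp _ _ c2 (@chart_inv_cvg R d G x))
      (@invg_continuous G x).
    rewrite -[e](mulgV x).
    by apply: (cvg_comp2 c1 c3 (h := fun y z : G => (y * z)%g)); exact: mulg_cvg.
  have [[A B] /= [xA /nbhs_ballP[r3 /= r3_gt0 Br3]] ABV] := cdiv _ nV.
  have xA' : nbhs (chart_at x x) (chart_inv (chart_at x) @^-1` A).
    exact: (@chart_inv_cvg R d G x).
  have /nbhs_ballP[rho /= rho_gt0 Hrho] := xA'.
  exists rho, r3; split=> // y u [dyu byu] bu.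
  have := ABV ((y * chart_inv (chart_at x) u)%g, u) => /=.
  rewrite mulgK; apply; split; last exact: Br3.
  by rewrite -(chart_atK dyu); apply: Hrho.
have [r4 r4_gt0 H4] := integral_tent_fin x.
(* small enough for the tent to be integrable as well *)
pose rho' := Num.min rho r4.
have rho'_gt0 : 0 < rho' by rewrite lt_min rho_gt0.
have I_gt0 := integral_tent_gt0 x rho'_gt0.
have I_fin : (\int[mu]_y (tent x rho' y)%:E < +oo)%E.
  by apply: H4; rewrite ge_min lexx orbT.
have I_num : (\int[mu]_y (tent x rho' y)%:E)%E \is a fin_num.
  by rewrite ge0_fin_numE// ltW.
pose I0 := fine (\int[mu]_y (tent x rho' y)%:E)%E.
have I0_gt0 : 0 < I0 by rewrite fine_gt0// I_gt0.
have V_num : mu (V : set (borel G)) \is a fin_num by rewrite ge0_fin_numE.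
pose mV' := fine (mu (V : set (borel G))).
pose r := Num.min r2 r3.
(* one inequality suffices, by symmetry; it is integrated from a pointwise one *)
have key u v : ball (chart_at x x) r u -> ball (chart_at x x) r v ->
    (Delta (chart_inv (chart_at x) u))^-1 * I0 <=
    (Delta (chart_inv (chart_at x) v))^-1 * I0 + L * `|u - v| * mV'.
  move=> bu bv.
  have bu3 : ball (chart_at x x) r3 u by apply: le_ball bu; rewrite ge_min lexx orbT.
  have bu2 : ball (chart_at x x) r2 u by apply: le_ball bu; rewrite ge_min lexx.
  have bv2 : ball (chart_at x x) r2 v by apply: le_ball bv; rewrite ge_min lexx.
  have Luv0 : 0 <= L * `|u - v| by rewrite mulr_ge0.
  rewrite -lee_fin EFinD !EFinM !fineK// -!integral_tent_mulg.
  rewrite -[X in mu X]setIT -integral_indic// -EFinM -ge0_integralZl//; first last.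
  - by apply/measurable_EFinP; exact: measurable_indic.
  have mt a : measurable_fun setT (fun y : borel G => (tent x rho' (y * a)%g)%:E).
    apply/measurable_EFinP.
    apply: (measurableT_comp (tent_measurable x rho') (@mulg_right_borel R d G a)).
  rewrite -ge0_integralD//; first last.
  - by apply: measurable_funeM; apply/measurable_EFinP; exact: measurable_indic.
  - by move=> y _; rewrite -EFinM lee_fin mulr_ge0.
  - by move=> y _; rewrite lee_fin tent_ge0.
  apply: ge0_le_integral => //.
  - by move=> y _; rewrite lee_fin tent_ge0.
  - apply: emeasurable_funD => //.
    by apply: measurable_funeM; apply/measurable_EFinP; exact: measurable_indic.
  move=> y _; rewrite -EFinM -EFinD lee_fin.
  have t0 b : 0 <= tent x rho' (y * b)%g + L * `|u - v| * \1_V y.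
    by rewrite addr_ge0 ?tent_ge0// mulr_ge0.
  rewrite {1}/tent; case: ifPn => [|//]; rewrite inE => ya.
  have Vy : V y.
    apply: (H3 y u) => //; case: ya => ? bya; split=> //.
    by apply: le_ball bya; rewrite ge_min lexx.
  rewrite indicE mem_set// mulr1.
  case: Vy => dy by1.
  have by2 : ball (chart_at e e) r2 (chart_at e y).
    by apply: le_ball by1; rewrite ge_min lexx orbT.
  pose z := row_mx (chart_at e y) u; pose w := row_mx (chart_at e y) v.
  have [||zd zw] := HL z w; [exact: ball_row_mx|exact: ball_row_mx|].
  have [||wd _] := HL w z; [exact: ball_row_mx|exact: ball_row_mx|].
  have ez : mulg_chart e x z = chart_at x (y * chart_inv (chart_at x) u)%g.
    by rewrite /mulg_chart row_mxKl row_mxKr chart_atK// mul1g.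
  have ew : mulg_chart e x w = chart_at x (y * chart_inv (chart_at x) v)%g.
    by rewrite /mulg_chart row_mxKl row_mxKr chart_atK// mul1g.
  have nzw : `|z - w| = `|u - v|.
    rewrite /z /w opp_row_mx add_row_mx subrr.
    apply/eqP; rewrite eq_le; apply/andP; split.
      apply: norm_le_coord => // j; rewrite mxE; case: splitP => k _.
        by rewrite mxE normr0.
      exact: coord_le_norm.
    apply: norm_le_coord => // j.
    by have := coord_le_norm (row_mx (0 : 'rV[R]_d) (u - v)) (rshift d j); rewrite row_mxEr.
  rewrite ez ew nzw in zw.
  have dv : chart_dom (chart_at x) (y * chart_inv (chart_at x) v)%g.
    by case: wd => _ _; rewrite row_mxKl row_mxKr chart_atK// mul1g.
  have tri := ler_distD (chart_at x (y * chart_inv (chart_at x) u)%g)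
    (chart_at x (y * chart_inv (chart_at x) v)%g) (chart_at x x).
  rewrite distrC in zw.
  rewrite /tent; case: ifPn => [_|]; first by lra.
  rewrite notin_setE => nv.
  have : rho' <= `|chart_at x (y * chart_inv (chart_at x) v)%g - chart_at x x|.
    rewrite leNgt; apply/negP => H; apply: nv; split=> //.
    by rewrite -ball_normE /= distrC.
  lra.
exists r, (L * mV' / I0); split.
- by rewrite lt_min r2_gt0.
- by rewrite !mulr_ge0 ?invr_ge0 ?(ltW I0_gt0)// fine_ge0.
move=> u v bu bv; rewrite mulrAC [L * _ * _]mulrAC ler_pdivlMr//.
rewrite -[X in _ * X](gtr0_norm I0_gt0) -normrM mulrBl ler_norml.
have := key _ _ bu bv; have := key _ _ bv bu; rewrite [`|v - u|]distrC.
by move=> h1 h2; apply/andP; split; lra.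
Qed.

(** Inversion is Lipschitz away from zero. *)
Lemma modular_lipschitz x : chart_lipschitz Delta x.
Proof.
have [D0 _] := modular.
have g2 : 0 < (Delta x)^-1 / 2 by rewrite divr_gt0 ?invr_gt0.
have -> : Delta = (fun y => ((Delta y)^-1)^-1).
  by apply/funext => y; rewrite invrK.
apply: (chart_lipschitz_comp (f := fun y => (Delta y)^-1)
  (C := ((Delta x)^-1 / 2)^-1 * ((Delta x)^-1 / 2)^-1)).
- by rewrite mulr_ge0 ?invr_ge0 ?ltW.
- by rewrite invr_gt0.
- move=> a b ga gb; have a0 := lt_le_trans g2 ga; have b0 := lt_le_trans g2 gb.
  have -> : a^-1 - b^-1 = a^-1 * b^-1 * (b - a) by field; rewrite !gt_eqF.
  rewrite normrM distrC ler_wpM2r// normrM !gtr0_norm ?invr_gt0//.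
  by apply: ler_pM; rewrite ?invr_ge0 ?(ltW a0) ?(ltW b0)// lef_pV2.
- exact: modular_inv_lipschitz.
Qed.

End Modular.

(** * Measurability of the score *)

Section Scores.
Context {R : realType} {d : nat} {G : lieGroupType R d}.
Implicit Types (x y : G).

Lemma chart_lipschitz_continuous (W : normedModType R) (f : G -> W) x :
  chart_lipschitz f x -> {for x, continuous f}.
Proof.
move=> [r [L [r0 L0 fL]]]; apply/cvgrPdist_lt => e e0.
have L1 : 0 < L + 1 by rewrite ltr_wpDl.
have e1 : 0 < Num.min r (e / (L + 1)) by rewrite lt_min r0 divr_gt0.
have nB : nbhs x (chart_ball x (Num.min r (e / (L + 1)))).
  apply: open_nbhs_nbhs; split; first exact: chart_ball_open.
  by split; [exact: chart_at_dom|exact: ballxx].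
apply: filterS nB => y [dy By].
rewrite -{1}(chart_atKx x) -{1}(chart_atK dy).
apply: le_lt_trans (fL _ _ (ballxx _ r0) _) _.
  by apply: le_ball By; rewrite ge_min lexx.
have : ball (chart_at x x) (e / (L + 1)) (chart_at x y).
  by apply: le_ball By; rewrite ge_min lexx orbT.
rewrite -ball_normE /= ltr_pdivlMr// mulrC; apply: le_lt_trans.
by rewrite ler_wpM2r// lerDl.
Qed.

(** The definition speaks of pairs of points in a whole chart; its instance at
    the diagonal point over [x] is the estimate on a ball. *)
Lemma locally_lipschitz_chart (f : G -> R) x :
  locally_lipschitz f -> chart_lipschitz f x.
Proof.
move=> /(_ _ (chart_at_atlas x)) /(_ (chart_at x x, chart_at x x)).
have c0 := nbhs_singleton (chart_cod_nbhs x).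
move=> /(_ (conj c0 c0)) [M [_ HM]].
have /HM : M < `|M| + 1 by rewrite (le_lt_trans (ler_norm M))// ltrDl.
move=> [[A B] /= [/nbhs_ballP[rA /= rA0 xA] /nbhs_ballP[rB /= rB0 xB]] AB].
have /nbhs_ballP[r /= r0 xr] := chart_cod_nbhs x.
exists (Num.min r (Num.min rA rB)), (`|M| + 1); split.
- by rewrite !lt_min r0 rA0.
- by rewrite addr_ge0.
move=> u v bu bv.
have /= := AB (u, v); apply.
  split; [apply: xA; apply: le_ball bu|apply: xB; apply: le_ball bv];
  by rewrite !ge_min lexx !orbT.
by split; [apply: xr; apply: le_ball bu|apply: xr; apply: le_ball bv];
  rewrite !ge_min lexx.
Qed.

(** [ln] is Lipschitz away from zero, by [ln (1 + t) <= t]. *)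
Lemma chart_lipschitz_ln (f : G -> R) x : 0 < f x ->
  chart_lipschitz f x -> chart_lipschitz (fun y => ln (f y)) x.
Proof.
move=> fx0; have f2 : 0 < f x / 2 by rewrite divr_gt0.
apply: (chart_lipschitz_comp (C := (f x / 2)^-1)) => //.
  by rewrite invr_ge0 ltW.
have ln_le (a b : R) : f x / 2 <= a -> f x / 2 <= b ->
    ln a - ln b <= (f x / 2)^-1 * `|a - b|.
  move=> fa fb; have a0 := lt_le_trans f2 fa; have b0 := lt_le_trans f2 fb.
  rewrite -ln_div ?posrE//.
  have -> : a / b = 1 + (a - b) / b by field; rewrite gt_eqF.
  apply: le_trans (le_ln1Dx _) _.
    by rewrite mulrBl divff ?gt_eqF// ltrDr divr_gt0.
  apply: (@le_trans _ _ (`|a - b| / b)).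
    by apply: ler_wpM2r; rewrite ?invr_ge0 ?(ltW b0) ?ler_norm.
  by rewrite mulrC ler_wpM2r// lef_pV2 ?posrE.
move=> a b fa fb.
by rewrite ler_norml lerNl opprB distrC !ln_le// distrC ln_le.
Qed.

Lemma curve_derive_measurable (f : borel G -> R) (B : set G) (v : 'rV[R]_d) :
  measurable_fun setT f -> open B -> (forall x, B x -> {for x, continuous (f : G -> R)}) ->
  measurable_fun (B : set (borel G)) (fun x : borel G =>
    lim (t^-1 *: (f (x * chart_line v t)%g - f x) @[t --> (0 : R)^'])).
Proof.
move=> mf oB cf; apply: (measurable_lim_dnbhs0
    (q := fun t (x : borel G) => t^-1 *: (f (x * chart_line v t)%g - f x))).
- exact: open_borel.
- move=> t _; apply: measurable_funTS.
  apply: (measurable_funM (measurable_cst _)); apply: measurable_funB => //.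
  exact: (measurableT_comp mf (mulg_right_borel _)).
move=> x Bx; have [r r0 cr] := @chart_line_continuous R d G v.
have cx t : `|t| < r -> (x * chart_line v t)%g @[t --> t] --> (x * chart_line v t)%g.
  move=> tr; apply: (cvg_comp2 (cvg_cst x) (cr t tr) (h := fun y z : G => (y * z)%g)).
  exact: mulg_cvg.
have : \forall t \near (0 : R), B (x * chart_line v t)%g.
  apply: cx; first by rewrite normr0.
  by apply: open_nbhs_nbhs; split=> //; rewrite chart_line0 mulg1.
move=> /nbhs_ballP[r' /= r'0 Br'].
exists (Num.min r r'); first by rewrite lt_min r0.
move=> t t0; rewrite lt_min => /andP[tr tr'].
apply: cvgZ; first exact: cvgV.
apply: cvgB; last exact: cvg_cst.
apply: (cvg_comp _ _ (cx t tr)); apply: cf; apply: Br'.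
by rewrite -ball_normE /= sub0r normrN.
Qed.

Variables (D : 'I_d -> G -> 'rV[R]_d) (LD : forall l, left_invariant (D l)).

Lemma vf_apply_measurable (f : G -> R) (B : set G) l :
  measurable_fun setT (f : borel G -> R) -> open B ->
  (forall x, B x -> chart_lipschitz f x) ->
  measurable_fun (B : set (borel G)) (vf_apply (D l) f : borel G -> R).
Proof.
move=> mf oB Lf; apply: (eq_measurable_fun (fun x : borel G =>
    lim (t^-1 *: (f (x * chart_line (D l 1%g) t)%g - f x) @[t --> (0 : R)^']))).
  by move=> x; rewrite inE => Bx; apply/esym/vf_apply_lim => //; exact: Lf.
apply: curve_derive_measurable => // x Bx.
exact/chart_lipschitz_continuous/Lf.
Qed.

(** Where [p] vanishes the value is 0 by definition; elsewhere [ln p] is Lipschitz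
    in charts. *)
Lemma Dlog_measurable (p : G -> R) l : (forall x, 0 <= p x) ->
  locally_lipschitz p -> measurable_fun setT (Dlog D p l : borel G -> R).
Proof.
move=> p0 Lp.
have cp : continuous p.
  by move=> x; exact/chart_lipschitz_continuous/locally_lipschitz_chart.
have mp := continuous_borel cp.
pose B := [set x | 0 < p x].
have oB : open B.
  apply: (@open_comp _ _ p [set y | 0 < y]) => [x _|].
    exact: cp.
  exact: open_gt.
have eB : (fun x : borel G => p x == 0) @^-1` [set false] = B.
  apply/seteqP; split=> x /=; rewrite /B /= lt_def p0 andbT; first by move=> ->.
  by move/negbTE.
apply: measurable_fun_if => //.
  by apply: (measurable_fun_bool false); rewrite setTI eB; exact: open_borel.
rewrite setTI eB; apply: vf_apply_measurable => //.
  by have := measurableT_comp (@measurable_ln R) mp.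
by move=> x px; apply: chart_lipschitz_ln => //; exact: locally_lipschitz_chart.
Qed.

Lemma vf_apply_modular_measurable (mu : {measure set (borel G) -> \bar R}) Delta l :
  left_haar mu -> modular_function mu Delta ->
  measurable_fun setT (vf_apply (D l) Delta : borel G -> R).
Proof.
move=> haar modular; apply: vf_apply_measurable.
- apply: continuous_borel => x.
  exact/chart_lipschitz_continuous/(modular_lipschitz haar modular).
- exact: openT.
- by move=> x _; exact: (modular_lipschitz haar modular).
Qed.

End Scores.

(** * Smoothness of the kernel sections *)

Section Sections.
Context {R : realType} {d : nat} {G : lieGroupType R d}.
Variables (k : G -> G -> R) (H : completeNormedModType R) (HK : rkhs k H).
Hypothesis k2 : Cn_prod 2 k.
Implicit Types (x y : G) (f g : H).
Local Notation "'<<' f , g '>>'" := (rkhs_dot HK f g).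
Local Notation K := (rkhs_section HK).

Lemma dot_section x y : << K x, K y >> = k x y.
Proof. by rewrite rkhs_reproducing rkhs_sectionE. Qed.

Let Kc x (u : 'rV[R]_d) : H := K (chart_inv (chart_at x) u).

(** The inner product of two increments of [K] is a mixed second difference of
    [k], since [<K x, K y> = k x y]. *)
Lemma section_increments x : exists M : 'I_d -> 'I_d -> R,
  forall e : R, 0 < e -> exists2 r : R, 0 < r &
    forall a a' b b', ball (chart_at x x) r a -> ball (chart_at x x) r a' ->
      ball (chart_at x x) r b -> ball (chart_at x x) r b' ->
    exists N : 'I_d -> 'I_d -> R, (forall i j, `|N i j - M i j| < e) /\
      << Kc x a - Kc x a', Kc x b - Kc x b' >> =
      \sum_i \sum_j (a - a') 0 i * (b - b') 0 j * N i j.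
Proof.
have C2 := k2 (chart_at_atlas x) (chart_at_atlas x).
set U := [set z | _] in C2; set f := (fun z => _) in C2.
have nU : nbhs (row_mx (chart_at x x) (chart_at x x)) U.
  have cl := @lsubmx_continuous R d d (row_mx (chart_at x x) (chart_at x x)).
  have cr := @rsubmx_continuous R d d (row_mx (chart_at x x) (chart_at x x)).
  have := chart_cod_nbhs x.
  rewrite -{1}(row_mxKl (chart_at x x) (chart_at x x)) => /cl nl.
  have := chart_cod_nbhs x.
  rewrite -{1}(row_mxKr (chart_at x x) (chart_at x x)) => /cr nr.
  have F0 := nbhs_filter (row_mx (chart_at x x) (chart_at x x)).
  exact: (@filterI _ _ F0 _ _ nl nr).
have [M HM] := second_difference C2 nU; exists M => e /HM[r r0 Hr].
exists r => // a a' b b' xa xa' xb xb'.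
have [N [NM E]] := Hr _ _ _ _ xa xa' xb xb'; exists N; split=> //.
apply: etrans E; rewrite /f !row_mxKl !row_mxKr -!dot_section dotBl !dotBr /Kc; ring.
Qed.

Lemma section_lipschitz x : chart_lipschitz K x.
Proof.
have [M /(_ _ ltr01)[r r0 Hr]] := section_increments x.
pose C := \sum_i \sum_j (`|M i j| + 1).
have C0 : 0 <= C.
  by apply: sumr_ge0 => i _; apply: sumr_ge0 => j _; rewrite addr_ge0.
exists r, (C + 1); split=> //; first by rewrite addr_ge0.
move=> u v bu bv; have [N [NM E]] := Hr _ _ _ _ bu bv bu bv.
rewrite -ler_sqr ?nnegrE ?mulr_ge0 ?addr_ge0// -(rkhs_dot_norm HK) E.
apply: (@le_trans _ _ (C * `|u - v| ^+ 2)).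
  rewrite mulr_suml; apply: ler_sum => i _; rewrite mulr_suml.
  apply: ler_sum => j _; apply: le_trans (ler_norm _) _.
  rewrite !normrM mulrC expr2; apply: ler_pM; rewrite ?mulr_ge0//.
    have := NM i j; have := ler_normD (N i j - M i j) (M i j); rewrite subrK.
    by move=> h1 /ltW h2; apply: le_trans h1 _; rewrite addrC lerD2l.
  by apply: ler_pM => //; exact: coord_le_norm.
rewrite exprMn ler_wpM2r ?exprn_ge0// expr2; nra.
Qed.

Lemma section_continuous : continuous K.
Proof. by move=> x; apply/chart_lipschitz_continuous/section_lipschitz. Qed.

(** All inner products of difference quotients tend to the same limit, the second
    derivative of [k] in the direction [v] in both variables; hence the quotients
    are Cauchy. *)
Lemma section_derivable x v :
  exists P : H, is_derive (chart_at x x) v (K \o chart_inv (chart_at x)) P.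
Proof.
suff [P KP] : exists P : H, t^-1 *: (Kc x (t *: v + chart_at x x) -
    Kc x (chart_at x x)) @[t --> (0 : R)^'] --> P by exists P; exact/is_deriveP.
have [M HM] := section_increments x.
pose S := \sum_i \sum_j `|v 0 i| * `|v 0 j|.
have S0 : 0 <= S.
  by apply: sumr_ge0 => i _; apply: sumr_ge0 => j _; rewrite mulr_ge0.
have S1 : 0 < S + 1 by rewrite ltr_wpDl.
pose Q := \sum_i \sum_j v 0 i * v 0 j * M i j.
pose q t := t^-1 *: (Kc x (t *: v + chart_at x x) - Kc x (chart_at x x)).
apply: (@cauchy_dnbhs0_cvg _ _ q) => e e0.
have e4 : 0 < e ^+ 2 / (4 * (S + 1)) by rewrite divr_gt0 ?exprn_gt0// mulr_gt0.
have [r r0 Hr] := HM _ e4.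
have N0 : 0 < `|v| + 1 by rewrite ltr_wpDl.
exists (r / (`|v| + 1)) => [|s t s0 t0]; first exact: divr_gt0.
move=> /(ball_line (chart_at x x)) bs /(ball_line (chart_at x x)) bt.
have b0 := ballxx (chart_at x x) r0.
have dq (a b : R) : a != 0 -> b != 0 ->
    ball (chart_at x x) r (a *: v + chart_at x x) ->
    ball (chart_at x x) r (b *: v + chart_at x x) ->
    `|<< q a, q b >> - Q| <= S * (e ^+ 2 / (4 * (S + 1))).
  move=> a0 b0' ba bb; have [N [NM E]] := Hr _ _ _ _ ba b0 bb b0.
  rewrite /q dotZl dotZr E !addrK.
  have -> : a^-1 * (b^-1 * (\sum_i \sum_j (a *: v) 0 i * (b *: v) 0 j * N i j)) =
      \sum_i \sum_j v 0 i * v 0 j * N i j.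
    rewrite mulrA mulr_sumr; apply: eq_bigr => i _; rewrite mulr_sumr.
    apply: eq_bigr => j _; rewrite !mxE; field.
    by rewrite a0 b0'.
  rewrite -sumrB mulr_suml; apply: le_trans (ler_norm_sum _ _ _) _.
  apply: ler_sum => i _; rewrite -sumrB mulr_suml.
  apply: le_trans (ler_norm_sum _ _ _) _; apply: ler_sum => j _.
  by rewrite -mulrBr normrM normrM ler_wpM2l ?mulr_ge0// ltW.
rewrite -ltr_sqr ?nnegrE// ?ltW// (norm_subE HK).
have := dq s s s0 s0 bs bs; have := dq s t s0 t0 bs bt.
have := dq t t t0 t0 bt bt.
have : S * (e ^+ 2 / (4 * (S + 1))) < e ^+ 2 / 4.
  have -> : S * (e ^+ 2 / (4 * (S + 1))) = e ^+ 2 / 4 * (S / (S + 1)).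
    by field; rewrite gt_eqF.
  rewrite gtr_pMr ?divr_gt0 ?exprn_gt0//.
  by rewrite ltr_pdivrMr// mul1r ltrDl.
move: (S * _) => Z hZ /ler_normlP[? ?] /ler_normlP[? ?] /ler_normlP[? ?]; lra.
Qed.

(** Pairing with a fixed vector is continuous, so it commutes with the limit of
    the difference quotients. *)
Lemma rkhs_fun_derive x v P f :
  is_derive (chart_at x x) v (K \o chart_inv (chart_at x)) P ->
  'D_v (rkhs_fun HK f \o chart_inv (chart_at x)) (chart_at x x) = << f, P >>.
Proof.
move=> /is_deriveP KP.
suff [_ ->//] : is_derive (chart_at x x) v
    (rkhs_fun HK f \o chart_inv (chart_at x)) << f, P >>.
have cq := @dot_cvg _ _ _ _ HK _ _ _ _ _ f KP.
apply/is_deriveP; rewrite rkhs_dotC.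
set q := (q in q @ _ --> _).
suff -> : q = fun t : R => << t^-1 *: ((K \o chart_inv (chart_at x))
    (t *: v + chart_at x x) - (K \o chart_inv (chart_at x)) (chart_at x x)), f >>.
  exact: cq.
apply/funext => t.
by rewrite /q dotZl dotBl /= ![<< _, f >>]rkhs_dotC !rkhs_reproducing.
Qed.

End Sections.

(** * The representer of the Stein operator *)

Section SeparableRange.
Context {R : realType} {d : nat} {G : lieGroupType R d} {H : normedModType R}.
Implicit Types (F : G -> H).

(** Separability of the range, with approximants not required to lie in it: in
    this form it passes to sums, multiples and limits. *)
Definition separable_range F := exists h : nat -> H,
  forall x (e : R), 0 < e -> exists i, `|F x - h i| < e.

(** One point is chosen in each set of a countable basis. *)
Lemma separable_continuous F : continuous F -> separable_range F.
Proof.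
move=> cF; have [U [Uo Ub]] := @countable_basis R d G.
exists (fun n => F (get (U n))) => x e e0.
have /Ub[n Ux UF] : nbhs x (F @^-1` ball (F x) e).
  by apply: cF; apply: nbhsx_ballx.
by exists n; have := UF _ (getI Ux); rewrite /= -ball_normE.
Qed.

Lemma separable_add F F' :
  separable_range F -> separable_range F' -> separable_range (F \+ F').
Proof.
move=> [h Hh] [h' Hh'].
exists (fun n => if unpickle n is Some (i, j) then h i + h' j else 0) => x e e0.
have e2 : 0 < e / 2 by rewrite divr_gt0.
have [i Hi] := Hh x _ e2; have [j Hj] := Hh' x _ e2.
exists (pickle (i, j)); rewrite pickleK /= opprD addrACA.
by apply: le_lt_trans (ler_normD _ _) _; rewrite (splitr e) ltrD.
Qed.

Lemma separable_scale (b : G -> R) F :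
  separable_range F -> separable_range (fun x => b x *: F x).
Proof.
move=> [h Hh].
exists (fun n => if unpickle n is Some (a, i) then ratr (a : rat) *: h i else 0).
move=> x e e0; have e2 : 0 < e / 2 by rewrite divr_gt0.
have F1 : 0 < `|F x| + 1 by rewrite ltr_wpDl.
have [a] : exists a : rat, ratr a \in
    `]b x - e / 2 / (`|F x| + 1), b x + e / 2 / (`|F x| + 1)[.
  by apply: rat_in_itvoo; rewrite ltrBlDr -addrA ltrDl addr_gt0 ?divr_gt0.
rewrite in_itv /= -ltr_distl => ba.
have a1 : 0 < `|ratr a : R| + 1 by rewrite ltr_wpDl.
have [i Hi] := Hh x _ (divr_gt0 e2 a1).
exists (pickle (a, i)); rewrite pickleK.
move: (ratr a : R) ba a1 Hi => r ba a1 Hi.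
have -> : b x *: F x - r *: h i = (b x - r) *: F x + r *: (F x - h i).
  by rewrite scalerBl scalerBr addrA subrK.
apply: le_lt_trans (ler_normD _ _) _; rewrite (splitr e) !normrZ ltrD//.
  rewrite ltr_pdivlMr// in ba; rewrite distrC.
  by apply: le_lt_trans ba; rewrite ler_wpM2l// lerDl.
rewrite ltr_pdivlMr// in Hi; apply: le_lt_trans Hi.
by rewrite mulrC ler_wpM2l// lerDl.
Qed.

Lemma separable_lim (Fn : nat -> G -> H) F :
  (forall n, separable_range (Fn n)) ->
  (forall x, Fn n x @[n --> \oo] --> F x) -> separable_range F.
Proof.
move=> /choice[h Hh] FnF.
exists (fun n => if unpickle n is Some (i, j) then h i j else 0) => x e e0.
have e2 : 0 < e / 2 by rewrite divr_gt0.
have /cvgrPdist_lt/(_ _ e2)[n _ /(_ n (leqnn n)) Hn] := FnF x.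
have [i Hi] := Hh n x _ e2.
exists (pickle (n, i)); rewrite pickleK.
by rewrite -(subrKA (Fn n x)) (le_lt_trans (ler_normD _ _))// (splitr e) ltrD.
Qed.

End SeparableRange.

Section Representer.
Context {R : realType} {d : nat} {G : lieGroupType R d}.
Variables (mu : {measure set (borel G) -> \bar R}) (Delta : G -> R)
  (D : 'I_d -> G -> 'rV[R]_d) (p : G -> R)
  (k : G -> G -> R) (H : completeNormedModType R) (HK : rkhs k H).
Hypotheses (haar : left_haar mu) (modular : modular_function mu Delta)
  (LD : forall l, left_invariant (D l)) (p0 : forall x, 0 <= p x)
  (Lp : locally_lipschitz p) (k2 : Cn_prod 2 k).
Implicit Types (x y : G) (f g : H).
Local Notation "'<<' f , g '>>'" := (rkhs_dot HK f g).
Local Notation K := (rkhs_section HK).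

Let score l x := Dlog D p l x + vf_apply (D l) Delta x.

(** Besides representing the operator, [Ak l x] is exhibited as a limit of
    expressions in which [x] occurs only through continuous maps and the score:
    both measurability and separability are read off this limit. *)
Lemma stein_representer : exists Ak : 'I_d -> G -> H,
  (forall l f x, stein_comp D Delta p l (rkhs_fun HK f) x = << f, Ak l x >>) /\
  forall l x, n.+1%:R *: (K (x * chart_line (D l 1%g) n.+1%:R^-1)%g - K x) +
    score l x *: K x @[n --> \oo] --> Ak l x.
Proof.
have /choice[P HP] (lx : 'I_d * G) : exists P : H,
    is_derive (chart_at lx.2 lx.2) (D lx.1 lx.2) (K \o chart_inv (chart_at lx.2)) P.
  exact: section_derivable.
exists (fun l x => P (l, x) + score l x *: K x); split=> [l f x|l x].
  have dP := HP (l, x).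
  rewrite /stein_comp {1}/vf_apply /tangent_map (rkhs_fun_derive _ dP).
  by rewrite dotDr dotZr rkhs_reproducing /score; ring.
apply: cvgD; last exact: cvg_cst.
have /(left_invariant_derive _ (LD l) (section_lipschitz HK k2 x)) := HP (l, x).
move=> /cvg_dnbhs0P PK; apply/cvgrPdist_lt => e /PK[r r0 Hr].
have [n nr] := invS_lt r0; exists n => // j /= nj; rewrite distrC.
have := Hr j.+1%:R^-1; rewrite invrK; apply=> //.
rewrite gtr0_norm//; apply: le_lt_trans nr.
by rewrite lef_pV2 ?posrE// ler_nat.
Qed.

Lemma score_measurable l : measurable_fun setT (score l : borel G -> R).
Proof.
apply: measurable_funD; first exact: (Dlog_measurable LD l p0 Lp).
exact: (vf_apply_modular_measurable LD l haar modular).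
Qed.

Lemma section_increment_continuous a (c : R) :
  continuous (fun x => c *: (K (x * a)%g - K x)).
Proof.
move=> x; apply: cvgZ; first exact: cvg_cst.
apply: cvgB; last exact: section_continuous.
apply: (cvg_comp _ _ (@mulg_right_continuous R d G a x)).
exact: section_continuous.
Qed.

Lemma representer_separable l (A : G -> H) :
  (forall x, n.+1%:R *: (K (x * chart_line (D l 1%g) n.+1%:R^-1)%g - K x) +
    score l x *: K x @[n --> \oo] --> A x) -> separable_range A.
Proof.
apply: separable_lim => n; apply: separable_add.
  exact/separable_continuous/section_increment_continuous.
exact/separable_scale/separable_continuous/section_continuous.
Qed.

(** Before the limit, the square of the distance is a polynomial in the score with
    continuous coefficients. *)
Lemma representer_dist_measurable l (A : G -> H) v :
  (forall x, n.+1%:R *: (K (x * chart_line (D l 1%g) n.+1%:R^-1)%g - K x) +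
    score l x *: K x @[n --> \oo] --> A x) ->
  measurable_fun setT (fun x : borel G => `|A x - v|).
Proof.
move=> AE; pose W n x := n.+1%:R *: (K (x * chart_line (D l 1%g) n.+1%:R^-1)%g - K x) - v.
apply: (measurable_fun_cvg (h := fun n (x : borel G) => `|W n x + score l x *: K x|)).
  move=> n.
  have cW : continuous (W n).
    by move=> x; apply: cvgB; [exact: section_increment_continuous|exact: cvg_cst].
  have cK := section_continuous k2 (HK := HK).
  have -> : (fun x : borel G => `|W n x + score l x *: K x|) = fun x =>
      Num.sqrt (<< W n x, W n x >> + 2 * score l x * << W n x, K x >> +
                score l x ^+ 2 * << K x, K x >>).
    apply/funext => x; move: (W n x) (score l x) => y s.
    rewrite -[LHS]normr_id -sqrtr_sqr -(rkhs_dot_norm HK).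
    rewrite dotDl !dotDr !dotZl !dotZr [<< K x, y >>]rkhs_dotC.
    by congr Num.sqrt; ring.
  have mc (F F' : G -> H) : continuous F -> continuous F' ->
      measurable_fun setT (fun x : borel G => << F x, F' x >>).
    move=> cF cF'; apply: continuous_borel => x.
    exact: (dot_continuous (HK := HK) (cF x) (cF' x)).
  have ms := score_measurable l.
  apply: (measurableT_comp (continuous_measurable_fun (@sqrt_continuous R))).
  apply: measurable_funD; first apply: measurable_funD.
  - exact: mc.
  - by apply: measurable_funM; [exact: measurable_funM (measurable_cst _) ms|exact: mc].
  - by apply: measurable_funM; [exact: measurable_funX|exact: mc].
move=> x _; rewrite (_ : (fun n => _) = (fun n =>
    `|n.+1%:R *: (K (x * chart_line (D l 1%g) n.+1%:R^-1)%g - K x) +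
      score l x *: K x - v|)); last by apply/funext => n; rewrite /W addrAC.
by apply: cvg_norm; apply: cvgB; [exact: AE|exact: cvg_cst].
Qed.

End Representer.

(** * The discrepancy *)

(** Cauchy-Schwarz, with equality at the normalised vector [m]. *)
Lemma ereal_sup_dot_prod (R : realType) (d : nat) (G : lieGroupType R d)
    (k : G -> G -> R) (H : completeNormedModType R) (HK : rkhs k H) (m : 'I_d -> H) :
  ereal_sup [set (dot_prod HK f m)%:E | f in [set f | norm_prod HK f <= 1]] =
  (Num.sqrt (dot_prod HK m m))%:E.
Proof.
have dpB (f g : 'I_d -> H) (a b : R) : 0 <= a ^+ 2 * dot_prod HK f f
    - 2 * a * b * dot_prod HK f g + b ^+ 2 * dot_prod HK g g.
  rewrite /dot_prod !mulr_sumr -sumrB -big_split /= sumr_ge0// => l _.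
  have := dot_ge0 HK (a *: f l - b *: g l).
  rewrite dotBl !dotBr !dotZl !dotZr [rkhs_dot HK (g l) (f l)]rkhs_dotC.
  by move=> ?; lra.
have S0 : 0 <= dot_prod HK m m by apply: sumr_ge0 => l _; exact: dot_ge0.
apply/eqP; rewrite eq_le; apply/andP; split.
  apply: ge_ereal_sup => _ [f fm <-]; rewrite lee_fin.
  have ff : dot_prod HK f f <= 1.
    by move: fm; rewrite /= /norm_prod -[leRHS]sqrtr1 ler_sqrt.
  have := dpB f m (Num.sqrt (dot_prod HK m m)) 1.
  rewrite sqr_sqrtr// expr1n mul1r mulr1.
  have [S_eq0|S_neq0] := eqVneq (dot_prod HK m m) 0.
    move=> _; rewrite S_eq0 sqrtr0.
    have m0 l : m l = 0.
      have /psumr_eq0P : dot_prod HK m m = 0 by [].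
      move=> /(_ (fun l _ => dot_ge0 HK (m l)) l isT)/eqP.
      by rewrite rkhs_dot_norm sqrf_eq0 normr_eq0 => /eqP.
    by rewrite /dot_prod big1// => l _; rewrite m0 rkhs_dotC dot0l.
  have a0 : 0 < Num.sqrt (dot_prod HK m m) by rewrite sqrtr_gt0 lt_def S_neq0.
  have aa := sqr_sqrtr S0; move: aa a0 ff; move: (Num.sqrt _) => a <- a0 ff h.
  rewrite -(ler_pM2l a0); nra.
have [S_eq0|S_neq0] := eqVneq (dot_prod HK m m) 0.
  apply: ereal_sup_ubound; exists m => /=; last by rewrite S_eq0 sqrtr0.
  by rewrite /norm_prod S_eq0 sqrtr0.
have a0 : 0 < Num.sqrt (dot_prod HK m m) by rewrite sqrtr_gt0 lt_def S_neq0.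
have aa := sqr_sqrtr S0; set a := Num.sqrt _ in a0 aa *.
have E : dot_prod HK (fun l => a^-1 *: m l) m = a.
  have -> : dot_prod HK (fun l => a^-1 *: m l) m = a^-1 * dot_prod HK m m.
    by rewrite /dot_prod mulr_sumr; apply: eq_bigr => l _; rewrite dotZl.
  by rewrite -aa expr2 mulrA mulVf ?mul1r// gt_eqF.
apply: ereal_sup_ubound; exists (fun l => a^-1 *: m l); last by rewrite E.
rewrite /= /norm_prod.
have -> : dot_prod HK (fun l => a^-1 *: m l) (fun l => a^-1 *: m l) =
    a^-1 * dot_prod HK (fun l => a^-1 *: m l) m.
  rewrite /dot_prod mulr_sumr; apply: eq_bigr => l _.
  by rewrite !dotZl dotZr.
by rewrite E mulVf ?gt_eqF// sqrtr1.
Qed.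

Theorem theorem2 (R : realType) (d : nat) (G : lieGroupType R d)
  (mu : {measure set (borel G) -> \bar R}) (Delta : G -> R)
  (D : 'I_d -> G -> 'rV[R]_d)
  (k : G -> G -> R) (H : completeNormedModType R) (HK : rkhs k H)
  (p q : G -> R) :
  connected [set: G] ->
  left_haar mu ->
  modular_function mu Delta ->
  left_invariant_basis D ->
  kernel_function k ->
  probability_density mu p -> locally_lipschitz p ->
  probability_density mu q ->
  Cn_prod 2 k ->
  mu.-integrable setT
    (fun x => (Num.sqrt (stein_kernel D Delta p k x x) * p x)%:E) ->
  mu.-integrable setT
    (fun x => (Num.sqrt (stein_kernel D Delta p k x x) * q x)%:E) ->
  [/\ (forall l : 'I_d, exists Ak : G -> H,
         (forall x y : G, rkhs_fun HK (Ak x) y =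
            stein_comp D Delta p l (fun x' => k x' y) x) /\
         bochner_integrable (density_measure mu q) Ak),
      (forall f : 'I_d -> H,
         mu.-integrable setT (fun x => (stein_op D Delta p HK f x * q x)%:E)),
      (forall y : G, mu.-integrable setT
         (fun x => (stein_kernel D Delta p k x y * q x * q y)%:E)),
      mu.-integrable setT (fun y =>
         \int[mu]_x (stein_kernel D Delta p k x y * q x * q y)%:E)%E &
      ((KSD D Delta p HK mu q) ^+ 2 =
       \int[mu]_y \int[mu]_x
         (stein_kernel D Delta p k x y * q x * q y)%:E)%E ].
Proof.
move=> _ haar modular [LD _] [k_sym _] [mp p0 _] Lp [mq q0 q1] k2 _ kq.
have {}LD l : left_invariant (D l) by case: (LD l).
have [Ak [AkE AkL]] := stein_representer Delta p HK LD k2.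
have mA l v := representer_dist_measurable haar modular LD p0 Lp k2 v (AkL l).
have sA l := representer_separable k2 (AkL l).
have k_section y : (fun x' => k x' y) = rkhs_fun HK (rkhs_section HK y).
  by apply/funext => x'; rewrite rkhs_sectionE k_sym.
have AkK l x y : rkhs_fun HK (Ak l x) y =
    stein_comp D Delta p l (fun x' => k x' y) x.
  by rewrite k_section AkE rkhs_dotC rkhs_reproducing.
have kpE x y : stein_kernel D Delta p k x y =
    dot_prod HK (fun l => Ak l y) (fun l => Ak l x).
  rewrite /stein_kernel /dot_prod; apply: eq_bigr => l _.
  (* the inner application of the operator is again an element of the space *)
  under eq_fun do rewrite -AkK.
  by rewrite AkE rkhs_dotC.
have nA l x : `|Ak l x| <= Num.sqrt (stein_kernel D Delta p k x x).
  rewrite kpE -[leLHS]normr_id -sqrtr_sqr; apply: ler_wsqrtr.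
  rewrite /dot_prod (bigD1 l)//= rkhs_dot_norm lerDl.
  by apply: sumr_ge0 => i _; exact: dot_ge0.
have mnA l : measurable_fun setT (fun x : borel G => `|Ak l x|).
  by have := mA l 0; under eq_fun do rewrite subr0.
have iA l : mu.-integrable setT (fun x => (`|Ak l x| * q x)%:E).
  apply: (le_integrable measurableT _ _ kq).
    by apply/measurable_EFinP; exact: measurable_funM.
  move=> x _; rewrite !abse_EFin lee_fin !normrM ler_wpM2r//.
  by rewrite normr_id (le_trans (nA l x))// ler_norm.
have /choice[m Hm] l := weak_mean HK (mA l) mq q0 (iA l).
have opE f x : stein_op D Delta p HK f x = \sum_l rkhs_dot HK (f l) (Ak l x).
  by apply: eq_bigr => l _; rewrite AkE.
have iop (f : 'I_d -> H) :
    mu.-integrable setT (fun x => (stein_op D Delta p HK f x * q x)%:E).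
  have := integrable_sum measurableT (index_enum 'I_d) (P := xpredT)
    (fun l _ => dot_integrable HK (mA l) mq q0 (iA l) (f l)).
  by apply: eq_integrable => // x _; rewrite sumEFin opE mulr_suml.
have intop (f : 'I_d -> H) :
    (\int[mu]_x (stein_op D Delta p HK f x * q x)%:E = (dot_prod HK f m)%:E)%E.
  transitivity (\int[mu]_x (\sum_l (rkhs_dot HK (f l) (Ak l x) * q x)%:E)%E)%E.
    by apply: eq_integral => x _; rewrite sumEFin opE mulr_suml.
  rewrite (integral_sum measurableT); last by move=> l; exact: dot_integrable.
  by rewrite -sumEFin; apply: eq_bigr => l _; rewrite Hm.
have kpop x y : stein_kernel D Delta p k x y * q x * q y =
    q y * (stein_op D Delta p HK (fun l => Ak l y) x * q x).
  by rewrite kpE opE mulrC.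
(* integrating over [x] first leaves the operator applied to the mean [m], of
   which [intop] then gives the second integral *)
have intkp y : (\int[mu]_x (stein_kernel D Delta p k x y * q x * q y)%:E =
    (stein_op D Delta p HK m y * q y)%:E)%E.
  under eq_integral do rewrite kpop EFinM.
  rewrite integralZl// intop -EFinM opE mulrC; congr (_ * _)%:E.
  by apply: eq_bigr => l _; rewrite rkhs_dotC.
split.
- move=> l; exists (Ak l); split=> //.
  have [nu nuE] := density_measure_exists mu mq q0.
  have -> : density_measure mu q = nu by apply/funext => A; rewrite nuE.
  have [h Hh] := sA l.
  apply: (bochner_integrable_dense (mA l) _ Hh).
    by have := nuE setT; rewrite q1 => ->; rewrite ltry.
  rewrite (integral_density mq q0 nuE (mnA l))//.
  have /integrableP[_] := iA l.
  congr (_ < _)%E; apply: eq_integral => x _.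
  by rewrite abse_EFin ger0_norm ?mulr_ge0.
- exact: iop.
- move=> y; have := integrableZl measurableT (q y) (iop (fun l => Ak l y)).
  by apply: eq_integrable => // x _; rewrite kpop EFinM.
- by apply: eq_integrable (iop m) => // y _; rewrite intkp.
have -> : KSD D Delta p HK mu q = (Num.sqrt (dot_prod HK m m))%:E.
  rewrite -ereal_sup_dot_prod /KSD; congr ereal_sup.
  by apply/seteqP; split=> _ [f fm <-]; exists f => //; rewrite intop.
under eq_integral do rewrite intkp.
rewrite intop -EFin_expe sqr_sqrtr//.
by apply: sumr_ge0 => l _; exact: dot_ge0.
Qed.
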